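(* For every planar graph $G$, every dominating set $D$ of $G$, and every owner assignment $m:V(G)\to D$, $$W=\sum_{x\in V(G)\setminus D}(k_x-2)^+\le(4|D|-12)^+.$$ In particular, if $W>0$, then $W\le 4|D|-12$.
   Context: All graphs are finite, simple and undirected. For $z\in\mathbb R$, $z^+=\max\{z,0\}$. $N(v)$ is the open neighborhood of $v$. Let $D$ be a dominating set of $G$ (every vertex is in $D$ or has a neighbor in $D$). An owner assignment is a map $m:V(G)\to D$ such that $m(d)=d$ for every $d\in D$, and $xm(x)\in E(G)$ for every $x\notin D$. For $d\in D$ the owner block of $d$ is $B_d=m^{-1}(d)$. For $x\in V(G)\setminus D$ set $$C_{\mathrm{out}}(x)=\{c\in D\setminus\{m(x)\}:N(x)\cap B_c\neq\varnothing\},\qquad k_x=|C_{\mathrm{out}}(x)|.$$ *)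

(* Defs.v *)
From mathcomp Require Import all_boot all_order all_algebra.
From mathcomp Require Import reals.

Set Implicit Arguments.
Unset Strict Implicit.
Unset Printing Implicit Defensive.

Import Order.TTheory GRing.Theory Num.Theory.

Local Open Scope ring_scope.

(* A finite simple undirected graph is a symmetric irreflexive [e : rel T] on
   a finite type [T]. *)

Definition edge_set (T : finType) (e : rel T) : {set {set T}} :=
  [set [set uv.1; uv.2] | uv : T * T & e uv.1 uv.2].

Definition neighborhood (T : finType) (e : rel T) (v : T) : {set T} :=
  [set u | e v u].

(* Plane graphs are taken as in Diestel, Graph Theory, Sections 4.1-4.2: edges
   are arcs in R^2, and an arc is a finite union of straight line segments that
   is homeomorphic to [0, 1].  Such an arc is given by the sequence of its
   successive corners. *)

Definition on_segment (R : realType) (p q x : 'rV[R]_2) : Prop :=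
  exists2 t : R, 0 <= t <= 1 & x = (1 - t) *: p + t *: q.

Definition on_side (R : realType) (s : seq 'rV[R]_2) (i : nat)
    (x : 'rV[R]_2) : Prop :=
  (i.+1 < size s)%N /\ on_segment s`_i s`_i.+1 x.

Definition on_polyline (R : realType) (s : seq 'rV[R]_2)
    (x : 'rV[R]_2) : Prop :=
  exists i : nat, on_side s i x.

(* No side is degenerate, and two distinct sides meet only if they are
   consecutive, and then only in their common corner.  In particular the
   polyline is not closed. *)
Definition polygonal_arc (R : realType) (s : seq 'rV[R]_2) : Prop :=
  [/\ (1 < size s)%N,
      forall i : nat, (i.+1 < size s)%N -> s`_i <> s`_i.+1 &
      forall (i j : nat) (x : 'rV[R]_2), (i < j)%N ->
        on_side s i x -> on_side s j x -> j = i.+1 /\ x = s`_j].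

(* Arcs are undirected, so the corners may be listed in either direction. *)
Definition links (R : realType) (s : seq 'rV[R]_2) (p q : 'rV[R]_2) : Prop :=
  (head 0 s = p /\ last 0 s = q) \/ (head 0 s = q /\ last 0 s = p).

(* The last two clauses say that the interior of an edge contains no vertex and
   no point of another edge. *)
Definition plane_drawing (R : realType) (T : finType) (e : rel T)
    (pos : T -> 'rV[R]_2) (arc : {set T} -> seq 'rV[R]_2) : Prop :=
  [/\ injective pos,
      forall u v : T, e u v ->
        polygonal_arc (arc [set u; v]) /\
        links (arc [set u; v]) (pos u) (pos v),
      forall (E : {set T}) (w : T), E \in edge_set e ->
        on_polyline (arc E) (pos w) -> w \in E &
      forall (E F : {set T}) (x : 'rV[R]_2),
        E \in edge_set e -> F \in edge_set e -> E <> F ->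
        on_polyline (arc E) x -> on_polyline (arc F) x ->
        exists2 w : T, w \in E :&: F & x = pos w].

Definition planar (R : realType) (T : finType) (e : rel T) : Prop :=
  exists (pos : T -> 'rV[R]_2) (arc : {set T} -> seq 'rV[R]_2),
    plane_drawing e pos arc.

Definition dominating (T : finType) (e : rel T) (D : {set T}) : Prop :=
  forall v : T, v \in D \/ exists2 d : T, d \in D & e v d.

Definition owner_assignment (T : finType) (e : rel T) (D : {set T})
    (m : T -> T) : Prop :=
  [/\ forall x : T, m x \in D,
      forall d : T, d \in D -> m d = d &
      forall x : T, x \notin D -> e x (m x)].

Definition owner_block (T : finType) (m : T -> T) (d : T) : {set T} :=
  [set x | m x == d].

Definition C_out (T : finType) (e : rel T) (D : {set T}) (m : T -> T)
    (x : T) : {set T} :=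
  [set c in D :\ m x | neighborhood e x :&: owner_block m c != set0].

Definition pos_part (z : int) : int := Num.max z 0.

Definition W (T : finType) (e : rel T) (D : {set T}) (m : T -> T) : int :=
  \sum_(x | x \notin D) pos_part (#|C_out e D m x|%:Z - 2).

(* Main.v *)
Require Import Defs.
From mathcomp Require Import all_boot all_order all_algebra.
From mathcomp Require Import reals.
From mathcomp Require Import ring lra zify.

(* A plane drawing assigns to each edge E and vertex w the parity of the
   crossings of E with a vertical ray from w.  For disjoint polylines these
   parities satisfy a four-term identity (the vanishing of the van Kampen
   obstruction), which extends to vertex-disjoint walks and, summed over the
   independent pairs of edges of K_5 or K_{3,3}, yields 0 = 1.  So a planar graph
   has no K_5 or K_{3,3} minor, and only this is used from there on.

   Contract every owner block to get a graph H on D.  If H is 3-connected, the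
   vertices x of one block B_d satisfy sum (k_x - 2)^+ <= deg_H(d) - 2: otherwise
   one of them shares three neighbouring blocks with the others, and these are
   the roots of a K_3 minor of H - d, giving a K_5.  Summing over d and using
   |E(H)| <= 3|D| - 6 gives 2(3|D| - 6) - 2|D| = 4|D| - 12.  If H has a separator
   of at most two vertices, induct on the two sides: by K_{3,3}-freeness at most
   two vertices x in each separating block see both sides. *)

Set Implicit Arguments.
Unset Strict Implicit.
Unset Printing Implicit Defensive.

Import Order.TTheory GRing.Theory Num.Theory.

Local Open Scope ring_scope.

(** * Crossing parities of segments *)

(** When the four-term identities are added over all independent pairs, every crossing parity occurs
    twice, but for three pairs of vertices the order terms occur an odd number of times in each
    direction, and antisymmetry of the order makes the total odd. Using walks in place of edges lets
    the branch sets be treated directly, so no drawing is ever contracted. Faces are lost once the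
    drawing is dropped; the bound on |E(H)| is therefore proved by contracting edges, and the losses
    at separators are controlled by K_{3,3} alone.

    The constants leave little room. After a cut at two hubs the sides have |L| + 2 and |P| + 2
    blocks, and 4(|L| - 1) + 4(|P| - 1) + 4 is exactly 4|D| - 12, so the four straddling vertices
    may lose only 1 each. Merging the far side into one hub of the cut recovers the missing unit. At
    a single cut hub there may be many components, and excluding K_{3,3} does not limit the number
    of vertices that each see a different one; hence the maximal choice of L there. *)

Section Segments.
Variable R : realType.
Implicit Types (p q r s c : 'rV[R]_2) (a b g h : R).

(** Breaking ties of abscissas by ordinates amounts to tilting the vertical infinitesimally, so that
    vertical sides and aligned corners are covered by one definition of crossing parity. *)
Definition lexpos a b := (0 < a) || ((a == 0) && (0 < b)).

Lemma lexpos_comb al be a b g h : 0 < al -> 0 < be ->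
  lexpos a b -> lexpos g h -> lexpos (al * a + be * g) (al * b + be * h).
Proof.
move=> al0 be0 /orP[a0|/andP[/eqP-> b0]] /orP[g0|/andP[/eqP-> h0]];
  apply/orP; rewrite ?mulr0 ?add0r ?addr0.
- by left; rewrite addr_gt0 ?mulr_gt0.
- by left; rewrite mulr_gt0.
- by left; rewrite mulr_gt0.
- by right; rewrite eqxx addr_gt0 ?mulr_gt0.
Qed.

(** This turns a vector identity into the sign of one of its coefficients. *)
Lemma lexpos_scale al a b : lexpos (al * a) (al * b) -> lexpos a b -> 0 < al.
Proof.
move=> h1 /orP[a0|/andP[/eqP a0 b0]]; move: h1; rewrite /lexpos.
  by rewrite pmulr_lgt0 // mulf_eq0 (gt_eqF a0) orbF => /orP[//|/andP[/eqP->]];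
     rewrite mul0r ltxx.
by rewrite a0 mulr0 ltxx eqxx /= pmulr_lgt0.
Qed.

Definition lexlt p q := lexpos (q 0 0 - p 0 0) (q 0 1 - p 0 1).

Lemma point_eq p q : p 0 0 = q 0 0 -> p 0 1 = q 0 1 -> p = q.
Proof.
move=> h0 h1; apply/rowP => -[[|[|//]] lti].
- by rewrite (_ : Ordinal lti = 0) //; apply/val_inj.
- by rewrite (_ : Ordinal lti = 1) //; apply/val_inj.
Qed.

Lemma lexltC p q : p != q -> lexlt q p = ~~ lexlt p q.
Proof.
move=> npq; rewrite /lexlt /lexpos !subr_gt0 !subr_eq0 negb_or negb_and -!leNgt.
case: (ltgtP (p 0 0) (q 0 0)) => //= ex.
case: (ltgtP (p 0 1) (q 0 1)) => //= ey.
by rewrite (point_eq ex ey) eqxx in npq.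
Qed.

Lemma lexlt_trans q p r : lexlt p q -> lexlt q r -> lexlt p r.
Proof.
move=> pq qr; have := lexpos_comb ltr01 ltr01 pq qr.
by rewrite !mul1r /lexlt; congr lexpos; ring.
Qed.

(** Twice the signed area of the triangle p q r, positive when it is counterclockwise. *)
Definition orient p q r :=
  (q 0 0 - p 0 0) * (r 0 1 - p 0 1) - (q 0 1 - p 0 1) * (r 0 0 - p 0 0).

(* Parity of the crossings of the segment [p, q] with the vertical ray going up
   from [c], ties between abscissas being broken by the lexicographic order. *)
Definition below p q c :=
  if lexlt p c && ~~ lexlt q c then orient p q c < 0
  else if lexlt q c && ~~ lexlt p c then 0 < orient p q c else false.

Lemma belowC p q c : below p q c = below q p c.
Proof.
rewrite /below; have -> : orient q p c = - orient p q c by rewrite /orient; ring.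
by rewrite oppr_lt0 oppr_gt0; case: (lexlt p c) (lexlt q c) => [] [].
Qed.

Lemma below_degenerate p c : below p p c = false.
Proof. by rewrite /below andbN. Qed.

Definition segments_disjoint p q r s :=
  forall x, on_segment p q x -> on_segment r s x -> False.

Lemma on_segmentC p q x : on_segment p q x -> on_segment q p x.
Proof.
case=> t /andP[t0 t1] ->; exists (1 - t); first by apply/andP; split; lra.
by rewrite addrC; congr (_ *: _ + _); lra.
Qed.

Lemma on_segment_l p q : on_segment p q p.
Proof. by exists 0; rewrite ?lexx ?ler01 // subr0 scale1r scale0r addr0. Qed.

Lemma on_segment_r p q : on_segment p q q.
Proof. exact/on_segmentC/on_segment_l. Qed.

(** Cramer's rule: the lines meet at parameter t on p q and u on r s, with common denominator D, the
    cross product of q - p and s - r. The sign conditions put both parameters in [0, 1]. *)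
Lemma segments_cross p q r s :
  orient p q r <= 0 -> 0 <= orient p q s -> 0 < orient p q s - orient p q r ->
  0 <= orient r s p -> orient r s q <= 0 -> ~ segments_disjoint p q r s.
Proof.
move=> A0 C0 D0 E0 B0; set D := _ - _ in D0.
have dD : D = orient r s p - orient r s q by rewrite /D /orient; ring.
pose t := orient r s p / D; pose u := - orient p q r / D.
apply; first (exists t => //); last (exists u).
- by rewrite /t; apply/andP; split;
    [apply: divr_ge0 => //; apply: ltW | rewrite ler_pdivrMr // mul1r dD; lra].
- by rewrite /u; apply/andP; split;
    [apply: divr_ge0; [lra|apply: ltW] | rewrite ler_pdivrMr // mul1r /D; lra].
have nD : D != 0 by rewrite gt_eqF.
have Et : t * D = orient r s p by rewrite divfK.
have Eu : u * D = - orient p q r by rewrite divfK.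
have comb v a b : ((1 - v) * a + v * b) * D = D * a + v * D * (b - a).
  by ring.
by apply: point_eq; rewrite !mxE; apply: (mulIf nD);
  rewrite !comb Et Eu /D /orient; ring.
Qed.

Lemma on_segment_collinear p q r :
  lexlt p r -> lexlt r q -> orient p q r = 0 -> on_segment p q r.
Proof.
rewrite /lexlt /orient => pr rq c0; pose a := q 0 0 - p 0 0.
have [ax|ax] := boolP (a == 0).
  have a0 : q 0 0 = p 0 0 by move/eqP: ax; rewrite /a; lra.
  have ex : r 0 0 = p 0 0.
    move: pr rq; rewrite /lexpos a0.
    by move=> /orP[?|/andP[/eqP ? _]] /orP[?|/andP[/eqP ? _]]; lra.
  move: pr rq; rewrite /lexpos a0 ex !subrr ltxx eqxx /= => pr rq.
  have d0 : 0 < q 0 1 - p 0 1 by lra.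
  pose t := (r 0 1 - p 0 1) / (q 0 1 - p 0 1).
  have Et : t * (q 0 1 - p 0 1) = r 0 1 - p 0 1 by rewrite divfK ?gt_eqF.
  exists t.
    by apply/andP; split; [apply: divr_ge0; lra | rewrite ler_pdivrMr //; lra].
  by apply: point_eq; rewrite !mxE ?a0 ?ex; lra.
have a0 : 0 < a.
  rewrite lt_neqAle eq_sym ax /=; move: pr rq; rewrite /lexpos /a.
  by move=> /orP[?|/andP[/eqP ? _]] /orP[?|/andP[/eqP ? _]]; lra.
pose t := (r 0 0 - p 0 0) / a.
have Et : t * a = r 0 0 - p 0 0 by rewrite divfK.
exists t.
  rewrite /t; move: pr rq; rewrite /lexpos => pr rq.
  rewrite divr_ge0 ?(ltW a0) //=; first last.
    by move: pr => /orP[?|/andP[/eqP ? _]]; lra.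
  by rewrite ler_pdivrMr // mul1r /a; move: rq => /orP[?|/andP[/eqP ? _]]; lra.
have comb a' b : ((1 - t) * a' + t * b) * a = a * a' + t * a * (b - a').
  by ring.
apply: point_eq; rewrite !mxE; apply: (mulIf ax); rewrite comb Et /a.
  by ring.
apply/eqP; rewrite -subr_eq0 -c0; apply/eqP; ring.
Qed.

(** Between r and q one of the two disjoint segments stays above the other. At the left end this is
    read by testing r against p q, at the right end by testing q against r s, with opposite
    outcomes. *)
Lemma below_overlap p q r s : segments_disjoint p q r s ->
  lexlt p r -> lexlt r q -> lexlt q s ->
  (orient p q r < 0) (+) (orient r s q < 0).
Proof.
move=> dis pr rq qs.
have rs := lexlt_trans rq qs; have ps := lexlt_trans pr rs.
have A0 : orient p q r != 0.
  apply/eqP => /(on_segment_collinear pr rq)/dis; apply; exact: on_segment_l.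
have B0 : orient r s q != 0.
  apply/eqP => /(on_segment_collinear rq qs) h; apply: (dis q) => //.
  exact: on_segment_r.
have pq := lexlt_trans pr rq.
set A := orient p q r in A0 *; set B := orient r s q in B0 *.
pose C := orient p q s; pose E := orient r s p.
(* Two vector identities, from which the signs of [C] and [E] are read off since
   the lexicographic order is compatible with positive combinations. *)
have key k : k * C * (q 0 0 - r 0 0) =
    - (k * B) * (q 0 0 - p 0 0) + - (k * A) * (s 0 0 - q 0 0) /\
  k * C * (q 0 1 - r 0 1) =
    - (k * B) * (q 0 1 - p 0 1) + - (k * A) * (s 0 1 - q 0 1).
  by rewrite /A /B /C /orient; split; ring.
have key2 k : k * E * (q 0 0 - p 0 0) =
    k * C * (r 0 0 - p 0 0) + - (k * A) * (s 0 0 - p 0 0) /\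
  k * E * (q 0 1 - p 0 1) =
    k * C * (r 0 1 - p 0 1) + - (k * A) * (s 0 1 - p 0 1).
  by rewrite /A /E /C /orient; split; ring.
(* The factor k is 1 when A and B are both negative and -1 when both are positive. *)
have CE k : 0 < - (k * A) -> 0 < - (k * B) -> 0 < k * C /\ 0 < k * E.
  move=> kA kB; have kC : 0 < k * C.
    have [e1 e2] := key k; apply: lexpos_scale rq; rewrite e1 e2.
    exact: lexpos_comb.
  split=> //; have [e1 e2] := key2 k; apply: lexpos_scale pq.
  by rewrite e1 e2; apply: lexpos_comb.
apply/negPn/negP => same.
have [A1|A1] := boolP (A < 0); move: same; rewrite ?A1 ?(negbTE A1).
  rewrite addTb negbK => B1.
  have [||] := CE 1; rewrite ?mul1r ?oppr_gt0 // => C1 E1.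
  apply: (@segments_cross p q r s (ltW A1) (ltW C1) _ (ltW E1) (ltW B1) dis).
  by rewrite subr_gt0; apply: lt_trans A1 C1.
rewrite addFb => B1.
have {}A1 : 0 < A by rewrite lt_neqAle eq_sym A0 leNgt.
have {}B1 : 0 < B by rewrite lt_neqAle eq_sym B0 leNgt.
have [||] := CE (-1); rewrite ?mulN1r ?opprK // !oppr_gt0 => C1 E1.
have srE x : orient s r x = - orient r s x by rewrite /orient; ring.
apply: (@segments_cross p q s r _ (ltW A1)); first exact: ltW.
- by rewrite subr_gt0; apply: lt_trans C1 A1.
- by rewrite srE oppr_ge0 ltW.
- by rewrite srE oppr_le0 ltW.
- by move=> x h1 /on_segmentC; apply: dis.
Qed.

(** With r and s on opposite sides of p q, the segment r s would cross the line at a point lying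
    between p and q, as both of its ends do. *)
Lemma below_nested p q r s : segments_disjoint p q r s ->
  lexlt p r -> lexlt r q -> lexlt p s -> lexlt s q ->
  (orient p q r < 0) = (orient p q s < 0).
Proof.
wlog : r s / orient p q r < 0.
  move=> W dis pr rq ps sq.
  case A: (orient p q r < 0); first by rewrite -A; apply: W.
  case C: (orient p q s < 0) => //; rewrite -A -C; apply/esym/W => //.
  by move=> x h1 /on_segmentC; apply: dis.
move=> A dis pr rq ps sq; rewrite A; apply/esym/negPn/negP => C.
have pq := lexlt_trans pr rq.
have {}C : 0 < orient p q s.
  rewrite lt_neqAle leNgt C andbT; apply/eqP => /esym.
  move=> /(on_segment_collinear ps sq) h; apply: (dis s) => //.
  exact: on_segment_r.
have nA : 0 < - orient p q r by rewrite oppr_gt0.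
have E : 0 < orient r s p.
  apply: lexpos_scale pq; move: (lexpos_comb C nA pr ps).
  by congr lexpos; rewrite /orient; ring.
have B : 0 < - orient r s q.
  apply: lexpos_scale pq; move: (lexpos_comb C nA rq sq).
  by congr lexpos; rewrite /orient; ring.
apply: (@segments_cross p q r s (ltW A) (ltW C) _ (ltW E) _ dis).
  by rewrite subr_gt0; apply: lt_trans A C.
by rewrite -oppr_ge0 ltW.
Qed.

(** For a linear order the right-hand side is 1 exactly when the pairs {p, q} and {r, s} interleave.
    The type is abstract so that the identity serves both for points of the plane and for vertices
    of a graph. *)
Definition four_term (P : Type) (b : P -> P -> P -> bool) (lt : P -> P -> bool)
    (p q r s : P) :=
  b p q r (+) b p q s (+) (b r s p (+) b r s q) =
  lt p r (+) lt p s (+) (lt q r (+) lt q s).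

(** Up to exchanging ends and exchanging the segments, the lexicographic intervals are in one of
    three positions: apart, interleaved or nested. *)
Lemma segments_four_term p q r s : segments_disjoint p q r s ->
  four_term below lexlt p q r s.
Proof.
rewrite /four_term => dis.
have swap p' q' r' s' : segments_disjoint p' q' r' s' ->
    segments_disjoint p' q' s' r' by move=> h x h1 /on_segmentC; apply: h.
have flip p' q' r' s' : segments_disjoint p' q' r' s' ->
    segments_disjoint r' s' p' q' by move=> h x h1 h2; apply: (h x).
have [->|npq] := eqVneq p q; first by rewrite !below_degenerate !addbb.
have [->|nrs] := eqVneq r s; first by rewrite !below_degenerate !addbb.
wlog pq : p q npq dis / lexlt p q.
  move=> W; have [h|h] := boolP (lexlt p q); first exact: W.
  have := W q p; rewrite eq_sym lexltC ?h // => /(_ npq) {}W.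
  rewrite [in LHS]belowC [X in _ (+) X (+) _]belowC.
  rewrite [in RHS]addbC [X in _ (+) X = _]addbC W //.
  by apply/flip/swap/flip.
wlog rs : r s nrs dis / lexlt r s.
  move=> W; have [h|h] := boolP (lexlt r s); first exact: W.
  have := W s r; rewrite eq_sym lexltC ?h // => /(_ nrs) {}W.
  rewrite ![below r s _]belowC [X in X (+) _ = _]addbC.
  rewrite [X in _ = X (+) _]addbC [X in _ = _ (+) X]addbC W //.
  exact/swap.
have npr : p != r.
  apply/eqP => h; apply: (dis p); [|rewrite h]; exact: on_segment_l.
have nps : p != s.
  apply/eqP => h; apply: (dis p); [|rewrite h];
   [exact: on_segment_l|exact: on_segment_r].
have nqr : q != r.
  apply/eqP => h; apply: (dis q); [|rewrite h];
   [exact: on_segment_r|exact: on_segment_l].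
have nqs : q != s.
  apply/eqP => h; apply: (dis q); [|rewrite h]; exact: on_segment_r.
wlog pr : p q r s npq nrs dis pq rs npr nps nqr nqs / lexlt p r.
  move=> W; case: (orP (orbN (lexlt p r))) => h; first exact: W.
  have rp : lexlt r p by rewrite lexltC.
  have {}W := W r s p q nrs npq (flip _ _ _ _ dis) rs pq.
  rewrite ![_ == p]eq_sym ![_ == q]eq_sym in W.
  rewrite addbC W // !(lexltC npr, lexltC nps, lexltC nqr, lexltC nqs).
  by case: (lexlt p r) (lexlt q r) (lexlt p s) (lexlt q s) => [] [] [] [].
have ps := lexlt_trans pr rs.
have [qr|qr] := boolP (lexlt q r).
  have qs := lexlt_trans qr rs.
  rewrite /below !(lexltC npr, lexltC nps, lexltC nqr, lexltC nqs).
  by rewrite pr ps qr qs.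
have rq : lexlt r q by rewrite lexltC.
have [qs|qs] := boolP (lexlt q s).
  have := below_overlap dis pr rq qs.
  rewrite /below pr ps qs (negbTE qr) rq /=.
  rewrite !(lexltC npr, lexltC nps, lexltC nqs) pr ps qs /=.
  by case: (_ < 0) (_ < 0) => [] [].
have sq : lexlt s q by rewrite lexltC.
have := below_nested dis pr rq ps sq.
rewrite /below pr ps (negbTE qr) (negbTE qs) rq sq /=.
rewrite !(lexltC npr, lexltC nps) pr ps /=.
by move=> ->; case: (_ < 0).
Qed.

End Segments.

(** * The van Kampen obstruction of a plane drawing *)

Section FourTerm.
Variables (P : Type) (b : P -> P -> P -> bool) (lt : P -> P -> bool).

Fixpoint path_sum (a : P) (s : seq P) (c : P) : bool :=
  if s is a' :: s' then b a a' c (+) path_sum a' s' c else false.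

Fixpoint chain (e : P -> P -> Prop) (a : P) (s : seq P) : Prop :=
  if s is a' :: s' then e a a' /\ chain e a' s' else True.

(** The identities for all pairs of sides, one from each path, are added. A term at an inner corner
    occurs once for each of the two sides meeting there and cancels mod 2, so only the ends of the
    paths remain. *)
Lemma path_sum_four_term (e e' : P -> P -> Prop) a s c t :
  (forall p q r u, e p q -> e' r u -> four_term b lt p q r u) ->
  chain e a s -> chain e' c t ->
  path_sum a s c (+) path_sum a s (last c t) (+)
    (path_sum c t a (+) path_sum c t (last a s)) =
  lt a c (+) lt a (last c t) (+) (lt (last a s) c (+) lt (last a s) (last c t)).
Proof.
move=> ft; elim: s a => [|a' s IH] a /=; first by rewrite !addbb.
case=> eaa' hs ht; have {IH hs} := IH a' hs ht.
have {ft} : b a a' c (+) b a a' (last c t) (+)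
    (path_sum c t a (+) path_sum c t a') =
    lt a c (+) lt a (last c t) (+) (lt a' c (+) lt a' (last c t)).
  elim: t c ht => [|c' t IH] c /=; first by rewrite !addbb.
  case=> ecc' ht; have := ft _ _ _ _ eaa' ecc'; have := IH c' ht.
  rewrite /four_term => h1 h2; rewrite [RHS]addbACA in h1.
  rewrite [RHS]addbACA in h2; rewrite [X in _ (+) X]addbACA [RHS]addbACA.
  move: h1 h2.
  move: (b c c' a (+) _) (path_sum c' t a (+) _) (_ (+) lt a' c) (_ (+) lt a' c')
    (_ (+) lt a' (last c' t)) (b a a' c) (b a a' c') (b a a' (last c' t)).
  by move=> [] [] [] [] [] [] [] [].
move=> h1 h2; rewrite [X in X (+) _ = _]addbACA; move: h1 h2.
move: (b a a' c (+) _) (path_sum a' s c (+) _) (_ (+) lt a (last c t))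
  (_ (+) lt a' (last c t)) (_ (+) lt (last a' s) (last c t))
  (path_sum c t a) (path_sum c t a') (path_sum c t (last a' s)).
by move=> [] [] [] [] [] [] [] [].
Qed.
End FourTerm.

Section Drawing.
Variables (R : realType) (T : finType) (e : rel T).

(* The mod 2 van Kampen obstruction vanishes: [X E w] plays the role of the
   parity of the number of crossings of the edge [E] with a vertical ray from
   the vertex [w]. *)
Definition unobstructed : Prop :=
  exists (X : {set T} -> T -> bool) (lt : rel T),
    (forall a b, a != b -> lt b a = ~~ lt a b) /\
    forall u v w z, e u v -> e w z -> [disjoint [set u; v] & [set w; z]] ->
      four_term (fun a b c => X [set a; b] c) lt u v w z.

Definition side (s : seq 'rV[R]_2) (p q : 'rV[R]_2) : Prop :=
  exists2 i, (i.+1 < size s)%N & p = s`_i /\ q = s`_i.+1.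

Lemma chain_side (s : seq 'rV[R]_2) : chain (side s) (head 0 s) (behead s).
Proof.
case: s => //= a s; have : forall i, (i <= size s)%N ->
    chain (side (a :: s)) (a :: s)`_i (drop i.+1 (a :: s)).
  move=> i; move: {-1}(size s - i)%N (erefl (size s - i)%N) => k.
  elim: k i => [|k IH] i ik le; first by rewrite drop_oversize //=; lia.
  have lt : (i < size s)%N by lia.
  rewrite (drop_nth 0) //=; split; first by exists i.
  by apply: IH; lia.
by move=> /(_ 0); rewrite /= drop0; apply.
Qed.

Lemma planar_unobstructed : planar R e -> unobstructed.
Proof.
case=> pos [arc [pos_inj arcP _ arc_meet]].
pose X E w := path_sum (@below R) (head 0 (arc E)) (behead (arc E)) (pos w).
exists X, (fun a b => lexlt (pos a) (pos b)); split=> [a b nab|].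
  by rewrite lexltC // (inj_eq pos_inj).
move=> u v w z uv wz dis; rewrite /four_term.
have in_edge a b : e a b -> [set a; b] \in edge_set e.
  by move=> ab; apply/imsetP; exists (a, b); rewrite ?inE.
have meet x : on_polyline (arc [set u; v]) x -> on_polyline (arc [set w; z]) x ->
    False.
  move=> h1 h2; have [|y] := arc_meet _ _ x (in_edge _ _ uv) (in_edge _ _ wz) _ h1 h2.
    move=> E; move: dis; rewrite E -setI_eq0 setIid => /eqP/setP/(_ w).
    by rewrite !inE eqxx.
  by rewrite -setI_eq0 in dis; rewrite (eqP dis) inE.
have ft := path_sum_four_term (b := @below R) (lt := @lexlt R)
  (e := side (arc [set u; v])) (e' := side (arc [set w; z])) _
  (@chain_side _) (@chain_side _).
have {ft} := ft _; have hyp p q r s : side (arc [set u; v]) p q ->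
    side (arc [set w; z]) r s -> four_term (@below R) (@lexlt R) p q r s.
  case=> i hi [-> ->] [j hj [-> ->]]; apply: segments_four_term => x hx hx'.
  by apply: (meet x); [exists i|exists j].
move=> /(_ hyp); rewrite /X.
have lastE a s : last (head a s) (behead s) = last a s :> 'rV[R]_2 by case: s.
rewrite !lastE.
have [_ [[-> ->]|[-> ->]]] := arcP _ _ uv; have [_ [[-> ->]|[-> ->]]] := arcP _ _ wz.
(* An arc may be listed from either end; both sides of the identity are invariant under this
   exchange. *)
all: do 4!move: (path_sum _ _ _ _); do 4!move: (lexlt _ _).
all: by move=> [] [] [] [] [] [] [] [].
Qed.

End Drawing.

(** * Connected sets and minors *)

Section Connectivity.
Variables (T : finType) (e : rel T).
Implicit Types (A B V : {set T}).

Definition restricted V : rel T := [rel x y | [&& x \in V, y \in V & e x y]].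

Lemma restrictedE V x y : restricted V x y = [&& x \in V, y \in V & e x y].
Proof. by []. Qed.

Definition connected V :=
  [forall a in V, forall b in V, connect (restricted V) a b].

Definition adjacent A B := [exists a in A, exists b in B, e a b].

Lemma connectedP V :
  reflect {in V &, forall a b, connect (restricted V) a b} (connected V).
Proof.
apply: (iffP idP) => [h a b aV bV|h].
  by move/forall_inP: h => /(_ a aV)/forall_inP; apply.
by apply/forall_inP => a aV; apply/forall_inP => b; apply: h.
Qed.

Lemma adjacentP A B :
  reflect (exists a b, [/\ a \in A, b \in B & e a b]) (adjacent A B).
Proof.
apply: (iffP exists_inP) => [[a aA /exists_inP[b bB ab]]|[a [b [aA bB ab]]]].
  by exists a, b.
by exists a => //; apply/exists_inP; exists b.
Qed.

Lemma connect_restrictedS V V' a b : V \subset V' ->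
  connect (restricted V) a b -> connect (restricted V') a b.
Proof.
move=> /subsetP sVV; apply: connect_sub => x y /and3P[xV yV xy].
by apply: connect1; rewrite restrictedE !sVV.
Qed.

Lemma connect_restricted_in V a b : connect (restricted V) a b ->
  a \in V -> b \in V.
Proof.
case/connectP => p; elim: p a => [|c p IH] a /=; first by move=> _ ->.
by case/andP => /and3P[_ cV _] pc lc _; apply: (IH c).
Qed.

(** The walk is cut at its first exit from [K], so its initial part stays inside [K]; [retraction]
    relies on that part. *)
Lemma connect_exit V (K : pred T) a b : connect (restricted V) a b ->
  K a -> ~~ K b -> exists x y,
    [/\ connect (restricted (V :&: [set z | K z])) a x,
        K x, ~~ K y, restricted V x y & x \in V].
Proof.
case/connectP => p; elim: p a => [|c p IH] a /=; first by move=> _ -> ->.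
case/andP => ac pc lc Ka nKb; have [Kc|nKc] := boolP (K c); last first.
  by exists a, c; split=> //; case/andP: ac.
have [x [y [cx Kx Ky xy xV]]] := IH c pc lc Kc nKb.
exists x, y; split=> //; apply: connect_trans cx; apply: connect1.
by case/and3P: ac => aV cV ac; rewrite restrictedE !inE aV cV Ka Kc.
Qed.

Hypothesis e_sym : symmetric e.

Lemma restricted_sym V : connect_sym (restricted V).
Proof. by apply: sym_connect_sym => x y; rewrite !restrictedE e_sym andbCA. Qed.

Lemma adjacentS A A' B B' : A \subset A' -> B \subset B' ->
  adjacent A B -> adjacent A' B'.
Proof.
move=> /subsetP sA /subsetP sB /adjacentP[a [b [aA bB ab]]].
by apply/adjacentP; exists a, b; rewrite sA ?sB.
Qed.

Lemma connected1 a : connected [set a].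
Proof.
by apply/connectedP => x y; rewrite !inE => /eqP-> /eqP->; apply: connect0.
Qed.

Lemma connected_hook A V : connected A -> A \subset V ->
  {in V, forall v, exists2 a, a \in A & connect (restricted V) v a} ->
  connected V.
Proof.
move=> /connectedP cA sAV hook; apply/connectedP => x y xV yV.
have [a aA xa] := hook x xV; have [b bA yb] := hook y yV.
apply: connect_trans xa _; rewrite restricted_sym; apply: connect_trans yb _.
by rewrite restricted_sym; apply: connect_restrictedS sAV _; apply: cA.
Qed.

Lemma connectedU A B : connected A -> connected B -> adjacent A B ->
  connected (A :|: B).
Proof.
move=> cA /connectedP cB /adjacentP[a [b [aA bB ab]]].
apply: (connected_hook cA) (subsetUl _ _) _ => v; rewrite inE => /orP[vA|vB].
  by exists v => //; apply: connect0.
exists a => //; apply: (@connect_trans _ _ b).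
  by apply: connect_restrictedS (subsetUr _ _) _; apply: cB.
by apply: connect1; rewrite restrictedE !inE aA bB e_sym ab orbT.
Qed.

Definition component V a := [set b in V | connect (restricted V) a b].

Lemma component_sub V a : component V a \subset V.
Proof. by apply/subsetP => x; rewrite inE => /andP[]. Qed.

Lemma component_self V a : a \in V -> a \in component V a.
Proof. by move=> aV; rewrite inE aV connect0. Qed.

Lemma component_closed V a x y : x \in component V a -> y \in V -> e x y ->
  y \in component V a.
Proof.
rewrite !inE => /andP[xV ax] yV xy; rewrite yV; apply: connect_trans ax _.
by apply: connect1; rewrite restrictedE xV yV.
Qed.

Lemma connected_component V a : connected (component V a).
Proof.
have main x : connect (restricted V) a x -> a \in V ->
    connect (restricted (component V a)) a x.
  move=> ax aV; have [//|nax] := boolP (connect (restricted (component V a)) a x).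
  have [z [y [_ az ay]]] := connect_exit ax (connect0 _ a) nax.
  case/and3P => zV yV zy _; case/negP: ay; apply: (connect_trans az).
  have cz := connect_restrictedS (component_sub V a) az.
  have zc : z \in component V a by rewrite inE zV cz.
  by apply: connect1; rewrite restrictedE zc zy (component_closed zc).
apply/connectedP => x y; rewrite !inE => /andP[xV ax] /andP[yV ay].
have [aV|naV] := boolP (a \in V).
  by apply: (@connect_trans _ _ a); [rewrite restricted_sym|]; apply: main.
by case/negP: naV; apply: connect_restricted_in xV; rewrite restricted_sym.
Qed.

Lemma restricted_path V a p : path (restricted V) a p ->
  path e a p /\ (a \in V -> all (mem V) (a :: p)).
Proof.
elim: p a => [|b p IH] a /=; first by split=> // ->.
case/andP => /and3P[aV bV ab] /IH[h1 h2]; rewrite ab h1; split=> // _.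
by rewrite aV; apply: h2.
Qed.

End Connectivity.

(** * Exclusion of K_5 and K_{3,3} minors *)

Section Minors.
Variables (T : finType) (e : rel T).
Implicit Types (A B V : {set T}).

(* Branch sets need not be required to be nonempty: adjacency forces it. *)
Definition K5_minor := exists s : seq {set T},
  [/\ size s = 5, all (connected e) s &
      pairwise (fun A B => [disjoint A & B] && adjacent e A B) s].

Definition K33_minor := exists s t : seq {set T},
  [/\ size s = 3, size t = 3, all (connected e) (s ++ t),
      pairwise (fun A B : {set T} => [disjoint A & B]) (s ++ t) &
      allrel (adjacent e) s t].

Definition minor_free :=
  [/\ symmetric e, irreflexive e, ~ K5_minor & ~ K33_minor].

Section Obstruction.
Hypothesis e_sym : symmetric e.
Variables (X : {set T} -> T -> bool) (lt : rel T).
Hypothesis ltC : forall a b, a != b -> lt b a = ~~ lt a b.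
Hypothesis X_ft : forall u v w z, e u v -> e w z ->
  [disjoint [set u; v] & [set w; z]] ->
  four_term (fun a b c => X [set a; b] c) lt u v w z.

(** Of a walk, only its crossing parities [g] with the rays from all vertices are kept. The set [V]
    confines it, so that independence of two routes can be read off the branch sets. *)
Definition route V a b (g : T -> bool) := exists p : seq T,
  [/\ path e a p, last a p = b, all (mem V) (a :: p) &
      g =1 path_sum (fun a b c => X [set a; b] c) a p].

Lemma route_exists A B a b : connected e A -> connected e B ->
  adjacent e A B -> a \in A -> b \in B -> exists g, route (A :|: B) a b g.
Proof.
move=> cA cB AB aA bB; have /connectedP/(_ a b) := connectedU e_sym cA cB AB.
rewrite !inE aA bB orbT => /(_ isT isT)/connectP[p pp lp].
have [pe pV] := restricted_path pp.
exists (path_sum (fun a b c => X [set a; b] c) a p), p; split=> //.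
by apply: pV; rewrite inE aA.
Qed.

(** The identity mod 2 becomes a sum in nat with an even value, so that the identities of all pairs
    of routes can be added by [ring] and refuted by [lia]. *)
Lemma route_parity V V' a b c d g g' : route V a b g -> route V' c d g' ->
  [disjoint V & V'] -> exists k,
  (g c + g d + g' a + g' b + lt a c + lt a d + lt b c + lt b d = k.*2)%N.
Proof.
case=> p [pe <- pV Eg] [q [qe <- qV Eg']] dis.
pose E (W : {set T}) x y := [/\ x \in W, y \in W & e x y].
have chainE (W : {set T}) x s : path e x s -> all (mem W) (x :: s) -> chain (E W) x s.
  elim: s x => //= y s IH x /andP[xy ys] /and3P[xW yW sW].
  by split=> //; apply: IH; rewrite //= yW.
have ft x y z t : E V x y -> E V' z t ->
    four_term (fun a b c => X [set a; b] c) lt x y z t.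
  case=> xV yV xy [zV tV zt]; apply: X_ft => //.
  by apply: disjointWl (disjointWr _ dis); apply/subsetP => w;
     rewrite !inE => /orP[] /eqP->.
have := path_sum_four_term ft (chainE V _ _ pe pV) (chainE V' _ _ qe qV).
rewrite !Eg !Eg'.
do 4!move: (path_sum _ _ _ _); do 4!move: (lt _ _).
by move=> x1 x2 x3 x4 x5 x6 x7 x8 h;
   exists (x1 + x2 + x3 + x4 + x5 + x6 + x7 + x8)./2;
   move: h; case: x1; case: x2; case: x3; case: x4; case: x5; case: x6;
   case: x7; case: x8.
Qed.

Lemma lt_nat a b : a != b -> (lt b a + lt a b = 1)%N.
Proof. by move/ltC ->; case: lt. Qed.

Lemma disjointUU A B A' B' : [disjoint A & A'] -> [disjoint A & B'] ->
  [disjoint B & A'] -> [disjoint B & B'] -> [disjoint A :|: B & A' :|: B'].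
Proof.
by rewrite -!setI_eq0 setIUl !setIUr => /eqP-> /eqP-> /eqP-> /eqP->; rewrite !setU0.
Qed.

Lemma disjoint_neq A B a b : [disjoint A & B] -> a \in A -> b \in B -> a != b.
Proof.
by move=> dis aA bB; apply: contraTneq aA => ->; rewrite (disjointFl dis).
Qed.

(** The sum runs over the 15 pairs of disjoint edges. An edge ij and a third vertex k occur together
    in two of them, because two edges at k avoid both i and j. *)
Lemma no_K5_minor : ~ K5_minor.
Proof.
case=> s [sz]; case: s sz => [|A1 [|A2 [|A3 [|A4 [|A5 [|? ?]]]]]] //= _.
rewrite !andbT => /and5P[c1 c2 c3 c4 c5].
case/and4P => /and4P[/andP[d12 a12] /andP[d13 a13] /andP[d14 a14] /andP[d15 a15]].
move=> /and3P[/andP[d23 a23] /andP[d24 a24] /andP[d25 a25]].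
move=> /andP[/andP[d34 a34] /andP[d35 a35]] /andP[d45 a45].
have /adjacentP[x1 [x2 [h1 h2 _]]] := a12.
have /adjacentP[x3 [x4 [h3 h4 _]]] := a34.
have /adjacentP[_ [x5 [_ h5 _]]] := a45.
have [g12 r12] := route_exists c1 c2 a12 h1 h2.
have [g13 r13] := route_exists c1 c3 a13 h1 h3.
have [g14 r14] := route_exists c1 c4 a14 h1 h4.
have [g15 r15] := route_exists c1 c5 a15 h1 h5.
have [g23 r23] := route_exists c2 c3 a23 h2 h3.
have [g24 r24] := route_exists c2 c4 a24 h2 h4.
have [g25 r25] := route_exists c2 c5 a25 h2 h5.
have [g34 r34] := route_exists c3 c4 a34 h3 h4.
have [g35 r35] := route_exists c3 c5 a35 h3 h5.
have [g45 r45] := route_exists c4 c5 a45 h4 h5.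
have D A B A' B' d1 d2 d3 d4 := @disjointUU A B A' B' d1 d2 d3 d4.
have dC A B : [disjoint A & B] -> [disjoint B & A] by rewrite disjoint_sym.
have [k1 e1] := route_parity r12 r34 (D _ _ _ _ d13 d14 d23 d24).
have [k2 e2] := route_parity r12 r35 (D _ _ _ _ d13 d15 d23 d25).
have [k3 e3] := route_parity r12 r45 (D _ _ _ _ d14 d15 d24 d25).
have [k4 e4] := route_parity r13 r24 (D _ _ _ _ d12 d14 (dC _ _ d23) d34).
have [k5 e5] := route_parity r13 r25 (D _ _ _ _ d12 d15 (dC _ _ d23) d35).
have [k6 e6] := route_parity r13 r45 (D _ _ _ _ d14 d15 d34 d35).
have [k7 e7] := route_parity r14 r23 (D _ _ _ _ d12 d13 (dC _ _ d24) (dC _ _ d34)).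
have [k8 e8] := route_parity r14 r25 (D _ _ _ _ d12 d15 (dC _ _ d24) d45).
have [k9 e9] := route_parity r14 r35 (D _ _ _ _ d13 d15 (dC _ _ d34) d45).
have [k10 e10] := route_parity r15 r23 (D _ _ _ _ d12 d13 (dC _ _ d25) (dC _ _ d35)).
have [k11 e11] := route_parity r15 r24 (D _ _ _ _ d12 d14 (dC _ _ d25) (dC _ _ d45)).
have [k12 e12] := route_parity r15 r34 (D _ _ _ _ d13 d14 (dC _ _ d35) (dC _ _ d45)).
have [k13 e13] := route_parity r23 r45 (D _ _ _ _ d24 d25 d34 d35).
have [k14 e14] := route_parity r24 r35 (D _ _ _ _ d23 d25 (dC _ _ d34) d45).
have [k15 e15] := route_parity r25 r34 (D _ _ _ _ d23 d24 (dC _ _ d35) (dC _ _ d45)).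
have l34 := lt_nat (disjoint_neq d34 h3 h4).
have l35 := lt_nat (disjoint_neq d35 h3 h5).
have l45 := lt_nat (disjoint_neq d45 h4 h5).
(* [M] takes one of every two equal terms. The pairs among x3, x4, x5 occur three times in each
   direction, so one term in each direction is left over, and [lt_nat] makes each such pair
   contribute 1. *)
pose M := (g12 x3 + g12 x4 + g34 x1 + g34 x2 + g12 x5 + g35 x1 + g35 x2 +
  g45 x1 + g45 x2 + g13 x2 + g13 x4 + g24 x1 + g24 x3 + g13 x5 + g25 x1 + g25
  x3 + g45 x3 + g14 x2 + g14 x3 + g23 x1 + g23 x4 + g14 x5 + g25 x4 + g35 x4 +
  g15 x2 + g15 x3 + g23 x5 + g15 x4 + g24 x5 + g34 x5 + lt x1 x3 + lt x1 x3 +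
  lt x1 x3 + lt x1 x4 + lt x1 x4 + lt x1 x4 + lt x2 x3 + lt x2 x3 + lt x2 x4 +
  lt x2 x4 + lt x1 x5 + lt x1 x5 + lt x1 x5 + lt x2 x5 + lt x2 x5 + lt x1 x2 +
  lt x1 x2 + lt x1 x2 + lt x3 x2 + lt x3 x4 + lt x3 x5 + lt x4 x2 + lt x4 x3 +
  lt x4 x5 + lt x5 x2 + lt x5 x3 + lt x5 x4)%N.
have E : (M + M + ((lt x4 x3 + lt x3 x4) + (lt x5 x3 + lt x3 x5) + (lt x5 x4
  + lt x4 x5)) = (k1 + k2 + k3 + k4 + k5 + k6 + k7 + k8 + k9 + k10 + k11 + k12
  + k13 + k14 + k15).*2)%N.
  rewrite !doubleD -e1 -e2 -e3 -e4 -e5 -e6 -e7 -e8 -e9 -e10 -e11 -e12 -e13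
  -e14 -e15 /M; ring.
rewrite l34 l35 l45 in E; move: M E; clear => M; lia.
Qed.

(** The same count over the 18 pairs of disjoint edges; the pairs left over are those among x4, x5,
    x6, on one side of the bipartition. *)
Lemma no_K33_minor : ~ K33_minor.
Proof.
case=> s [t [sz sz']]; case: s sz => [|A1 [|A2 [|A3 [|? ?]]]] //= _.
case: t sz' => [|A4 [|A5 [|A6 [|? ?]]]] //= _.
rewrite /allrel /= !andbT => /and5P[c1 c2 c3 c4 /andP[c5 c6]].
case/and5P => /and5P[d12 d13 d14 d15 d16] /and4P[d23 d24 d25 d26].
move=> /and3P[d34 d35 d36] /andP[d45 d46] d56.
case/and3P => /and3P[a14 a15 a16] /and3P[a24 a25 a26] /and3P[a34 a35 a36].
have /adjacentP[x1 [x4 [h1 h4 _]]] := a14.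
have /adjacentP[x2 [x5 [h2 h5 _]]] := a25.
have /adjacentP[x3 [x6 [h3 h6 _]]] := a36.
have [g14 r14] := route_exists c1 c4 a14 h1 h4.
have [g15 r15] := route_exists c1 c5 a15 h1 h5.
have [g16 r16] := route_exists c1 c6 a16 h1 h6.
have [g24 r24] := route_exists c2 c4 a24 h2 h4.
have [g25 r25] := route_exists c2 c5 a25 h2 h5.
have [g26 r26] := route_exists c2 c6 a26 h2 h6.
have [g34 r34] := route_exists c3 c4 a34 h3 h4.
have [g35 r35] := route_exists c3 c5 a35 h3 h5.
have [g36 r36] := route_exists c3 c6 a36 h3 h6.
have D A B A' B' d1 d2 d3 d4 := @disjointUU A B A' B' d1 d2 d3 d4.
have dC A B : [disjoint A & B] -> [disjoint B & A] by rewrite disjoint_sym.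
have [k1 e1] := route_parity r14 r25
  (D _ _ _ _ d12 d15 (dC _ _ d24) d45).
have [k2 e2] := route_parity r14 r26
  (D _ _ _ _ d12 d16 (dC _ _ d24) d46).
have [k3 e3] := route_parity r15 r24
  (D _ _ _ _ d12 d14 (dC _ _ d25) (dC _ _ d45)).
have [k4 e4] := route_parity r15 r26
  (D _ _ _ _ d12 d16 (dC _ _ d25) d56).
have [k5 e5] := route_parity r16 r24
  (D _ _ _ _ d12 d14 (dC _ _ d26) (dC _ _ d46)).
have [k6 e6] := route_parity r16 r25
  (D _ _ _ _ d12 d15 (dC _ _ d26) (dC _ _ d56)).
have [k7 e7] := route_parity r14 r35
  (D _ _ _ _ d13 d15 (dC _ _ d34) d45).
have [k8 e8] := route_parity r14 r36
  (D _ _ _ _ d13 d16 (dC _ _ d34) d46).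
have [k9 e9] := route_parity r15 r34
  (D _ _ _ _ d13 d14 (dC _ _ d35) (dC _ _ d45)).
have [k10 e10] := route_parity r15 r36
  (D _ _ _ _ d13 d16 (dC _ _ d35) d56).
have [k11 e11] := route_parity r16 r34
  (D _ _ _ _ d13 d14 (dC _ _ d36) (dC _ _ d46)).
have [k12 e12] := route_parity r16 r35
  (D _ _ _ _ d13 d15 (dC _ _ d36) (dC _ _ d56)).
have [k13 e13] := route_parity r24 r35
  (D _ _ _ _ d23 d25 (dC _ _ d34) d45).
have [k14 e14] := route_parity r24 r36
  (D _ _ _ _ d23 d26 (dC _ _ d34) d46).
have [k15 e15] := route_parity r25 r34
  (D _ _ _ _ d23 d24 (dC _ _ d35) (dC _ _ d45)).
have [k16 e16] := route_parity r25 r36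
  (D _ _ _ _ d23 d26 (dC _ _ d35) d56).
have [k17 e17] := route_parity r26 r34
  (D _ _ _ _ d23 d24 (dC _ _ d36) (dC _ _ d46)).
have [k18 e18] := route_parity r26 r35
  (D _ _ _ _ d23 d25 (dC _ _ d36) (dC _ _ d56)).
have l45 := lt_nat (disjoint_neq d45 h4 h5).
have l46 := lt_nat (disjoint_neq d46 h4 h6).
have l56 := lt_nat (disjoint_neq d56 h5 h6).
pose M := (g14 x2 + g14 x5 + g25 x1 + g25 x4 + g14 x6 + g26 x1 + g26 x4 +
  g15 x2 + g15 x4 + g24 x1 + g24 x5 + g15 x6 + g26 x5 + g16 x2 + g16 x4 + g24
  x6 + g16 x5 + g25 x6 + g14 x3 + g35 x1 + g35 x4 + g36 x1 + g36 x4 + g15 x3 +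
  g34 x1 + g34 x5 + g36 x5 + g16 x3 + g34 x6 + g35 x6 + g24 x3 + g35 x2 + g36
  x2 + g25 x3 + g34 x2 + g26 x3 + lt x1 x2 + lt x1 x2 + lt x1 x2 + lt x1 x5 +
  lt x1 x5 + lt x4 x2 + lt x4 x5 + lt x1 x6 + lt x1 x6 + lt x4 x6 + lt x1 x4 +
  lt x1 x4 + lt x5 x2 + lt x5 x4 + lt x5 x6 + lt x6 x2 + lt x6 x4 + lt x6 x5 +
  lt x1 x3 + lt x1 x3 + lt x1 x3 + lt x4 x3 + lt x4 x3 + lt x5 x3 + lt x5 x3 +
  lt x6 x3 + lt x6 x3 + lt x2 x3 + lt x2 x3 + lt x2 x3 + lt x2 x5 + lt x2 x6 +
  lt x2 x4)%N.
have E : (M + M + ((lt x5 x4 + lt x4 x5) + (lt x6 x4 + lt x4 x6) + (lt x6 x5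
  + lt x5 x6)) = (k1 + k2 + k3 + k4 + k5 + k6 + k7 + k8 + k9 + k10 + k11 + k12
  + k13 + k14 + k15 + k16 + k17 + k18).*2)%N.
  rewrite !doubleD -e1 -e2 -e3 -e4 -e5 -e6 -e7 -e8 -e9 -e10 -e11 -e12 -e13
  -e14 -e15 -e16 -e17 -e18 /M; ring.
rewrite l45 l46 l56 in E; move: M E; clear => M; lia.
Qed.

End Obstruction.

Lemma planar_minor_free (R : realType) :
  symmetric e -> irreflexive e -> planar R e -> minor_free.
Proof.
move=> e_sym e_irr /planar_unobstructed[X [lt [ltC ft]]].
by split=> //; [apply: no_K5_minor ft | apply: no_K33_minor ft].
Qed.

End Minors.

Local Open Scope nat_scope.

(** * Contractions along maps with connected fibers *)

Section Contraction.
Variables (T : finType) (e : rel T) (U : {set T}) (f : T -> T).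
Implicit Types (A B V : {set T}).

(** Contracted vertices are again elements of [T], so the inductions that pass to a contraction stay
    on one type. *)
Definition contract : rel T :=
  [rel i j | (i != j) && [exists u in U, exists v in U,
    [&& f u == i, f v == j & e u v]]].

Definition preimage A := [set u in U | f u \in A].

Hypothesis e_sym : symmetric e.
Hypothesis fiber_connected : forall i, connected e (preimage [set i]).

Lemma contractP i j : reflect
  (i != j /\ exists u v, [/\ u \in U, v \in U, f u = i, f v = j & e u v])
  (contract i j).
Proof.
apply: (iffP andP) => -[nij].
  move=> /exists_inP[u uU /exists_inP[v vU /and3P[/eqP ui /eqP vj uv]]].
  by split=> //; exists u, v.
case=> u [v [uU vU ui vj uv]]; split=> //; apply/exists_inP; exists u => //.
by apply/exists_inP; exists v => //; rewrite ui vj !eqxx.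
Qed.

Lemma contract_sym : symmetric contract.
Proof.
by move=> i j; apply/contractP/contractP => -[nij [u [v [uU vU ui vj uv]]]];
   (split; first by rewrite eq_sym); exists v, u; rewrite e_sym.
Qed.

Lemma contract_irr : irreflexive contract.
Proof. by move=> i; apply/contractP => -[]; rewrite eqxx. Qed.

Lemma preimageS A B : A \subset B -> preimage A \subset preimage B.
Proof.
move=> /subsetP sAB; apply/subsetP => u; rewrite !inE => /andP[->].
exact: sAB.
Qed.

Lemma connect_fiber A a u : a \in preimage A -> u \in U -> f u = f a ->
  connect (restricted e (preimage A)) a u.
Proof.
rewrite inE => /andP[aU faA] uU fu.
have /connectedP/(_ a u) := fiber_connected (f a).
rewrite !inE aU uU fu !eqxx => /(_ isT isT); apply: connect_restrictedS.
by apply: preimageS; rewrite sub1set.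
Qed.

Lemma connected_preimage A : connected contract A -> connected e (preimage A).
Proof.
move=> /connectedP cA; apply/connectedP => a b aA bA.
have [faA fbA] : f a \in A /\ f b \in A.
  by move: aA bA; rewrite !inE => /andP[_ ->] /andP[].
have /connectP[p] := cA _ _ faA fbA.
elim: p a aA {faA} => [|j p IH] a aA /=.
  by move=> _ ba; apply: connect_fiber => //; move: bA; rewrite inE => /andP[].
case/andP => /and3P[faA jA /contractP[_ [u [v [uU vU ua vj uv]]]]] pp lp.
have uA : u \in preimage A by rewrite inE uU ua.
have vA : v \in preimage A by rewrite inE vU vj.
apply: (connect_trans (connect_fiber aA uU ua)).
apply: (@connect_trans _ _ v); first by apply: connect1; rewrite restrictedE uA vA.
by apply: IH => //; rewrite vj.
Qed.

Lemma adjacent_preimage A B : adjacent contract A B ->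
  adjacent e (preimage A) (preimage B).
Proof.
case/adjacentP => i [j [iA jB /contractP[_ [u [v [uU vU ui vj uv]]]]]].
by apply/adjacentP; exists u, v; rewrite !inE uU vU ui vj.
Qed.

Lemma disjoint_preimage A B : [disjoint A & B] ->
  [disjoint preimage A & preimage B].
Proof.
move=> dAB; rewrite -setI_eq0; apply/eqP/setP => u; rewrite !inE.
by apply/andP => -[/andP[_ fA] /andP[_]]; rewrite (disjointFr dAB).
Qed.

(** Branch sets pull back along [f]: a minor of a minor is a minor. *)
Lemma minor_free_contract : minor_free e -> minor_free contract.
Proof.
case=> _ _ n5 n33; split; [exact: contract_sym|exact: contract_irr| |].
- case=> s [sz cs ps]; apply: n5; exists (map preimage s).
  rewrite size_map; split=> //.
    by rewrite all_map; apply: sub_all cs => A; apply: connected_preimage.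
  rewrite pairwise_map; apply: sub_pairwise ps => A B /andP[dAB aAB] /=.
  by rewrite disjoint_preimage ?adjacent_preimage.
case=> s [t [sz sz' cs ps al]]; apply: n33.
exists (map preimage s), (map preimage t).
rewrite !size_map -map_cat; split=> //.
- by rewrite all_map; apply: sub_all cs => A; apply: connected_preimage.
- rewrite pairwise_map; apply: sub_pairwise ps => A B /=.
  exact: disjoint_preimage.
- rewrite allrel_mapl allrel_mapr; apply: sub_allrel al => A B.
  exact: adjacent_preimage.
Qed.

End Contraction.

(** * The edge bound *)

Section EdgeBound.
Variable T : finType.
Implicit Types (e : rel T) (S : {set T}).

Definition nbrs e S u := [set v in S | e u v].

Lemma K5_of_vertices e a b c d x : minor_free e ->
  uniq [:: a; b; c; d; x] -> pairwise e [:: a; b; c; d; x] -> False.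
Proof.
move=> [_ _ n5 _] un pw; apply: n5.
exists (map (fun z => [set z]) [:: a; b; c; d; x]); split=> //.
  by rewrite all_map; apply/allP => z _; apply: connected1.
rewrite pairwise_map; move: un; rewrite uniq_pairwise => un.
have : pairwise (fun y z => (y != z) && e y z) [:: a; b; c; d; x].
  by rewrite pairwise_relI un pw.
apply: sub_pairwise => y z /= /andP[yz eyz].
rewrite disjoints1 inE yz; apply/adjacentP; exists y, z.
by rewrite !inE !eqxx.
Qed.

Lemma K33_of_vertices e a b c x y z : minor_free e ->
  uniq [:: a; b; c; x; y; z] -> allrel e [:: a; b; c] [:: x; y; z] -> False.
Proof.
move=> [_ _ _ n33] un al; apply: n33.
exists (map (fun z => [set z]) [:: a; b; c]), (map (fun z => [set z]) [:: x; y; z]).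
split=> //.
- by rewrite -map_cat all_map; apply/allP => ? _; apply: connected1.
- rewrite -map_cat pairwise_map; move: un; rewrite uniq_pairwise.
  by apply: sub_pairwise => u v /= uv; rewrite disjoints1 inE.
rewrite allrel_mapl allrel_mapr; apply: sub_allrel al => u v uv.
by apply/adjacentP; exists u, v; rewrite !inE !eqxx.
Qed.

Lemma connected_clique e (V : {set T}) :
  {in V &, forall a b, a != b -> e a b} -> connected e V.
Proof.
move=> cl; apply/connectedP => a b aV bV.
have [->|nab] := eqVneq a b; first exact: connect0.
by apply: connect1; rewrite restrictedE aV bV cl.
Qed.

Lemma mem_nbrs e S u v : (v \in nbrs e S u) = (v \in S) && e u v.
Proof. by rewrite inE. Qed.

Definition degree_sum e S := \sum_(u in S) #|nbrs e S u|.

Lemma degree_sumD1 e S u : symmetric e -> irreflexive e -> u \in S ->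
  degree_sum e S = (degree_sum e (S :\ u) + (#|nbrs e S u|).*2)%N.
Proof.
move=> e_sym e_irr uS; rewrite /degree_sum (bigD1 u) //=.
rewrite (eq_bigl (mem (S :\ u))) => [|x]; last by rewrite !inE andbC.
have -> : (\sum_(x in S :\ u) #|nbrs e S x| =
    \sum_(x in S :\ u) (#|nbrs e (S :\ u) x| + e u x))%N.
  apply: eq_bigr => x _; rewrite (cardsD1 u) mem_nbrs uS e_sym addnC.
  by congr (_ + _)%N; apply: eq_card => y; rewrite !inE andbA.
rewrite big_split /= [RHS]addnC -addnn -addnA; congr (_ + _)%N.
rewrite addnC; congr (_ + _)%N; rewrite -sum1_card big_mkcond [RHS]big_mkcond /=.
apply: eq_bigr => x _; rewrite !inE; case: (eqVneq x u) => [->|_] /=.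
  by rewrite e_irr andbF.
by case: (x \in S) => //=; case: (e u x).
Qed.

Definition fuse u v : T -> T := fun x => if x == u then v else x.

Lemma fuse_fiber_connected e S u v i : e u v -> symmetric e ->
  connected e (preimage S (fuse u v) [set i]).
Proof.
move=> uv e_sym; apply: connected_clique => a b; rewrite !inE /fuse.
move=> /andP[_ ha] /andP[_ hb]; move: ha hb.
have [->|_] := eqVneq a u; have [->|_] := eqVneq b u => /eqP <- /eqP hb nab.
- by [].
- by rewrite hb.
- by rewrite -hb e_sym.
- by rewrite hb eqxx in nab.
Qed.

(** Contracting u v loses that edge and, for each common neighbour, one of two edges that become
    parallel; every lost edge counts twice. *)
Lemma degree_sum_fuse e S u v : symmetric e -> irreflexive e ->
  u \in S -> v \in S -> e u v ->
  (degree_sum e S <= degree_sum (contract e S (fuse u v)) (S :\ u)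
     + 2 + (#|nbrs e S u :&: nbrs e S v|).*2)%N.
Proof.
move=> e_sym e_irr uS vS uv; rewrite (degree_sumD1 e_sym e_irr uS).
set e' := contract _ _ _; set c := _ :&: _; set S' := S :\ u.
have nvu : v != u by apply: contraTneq uv => ->; rewrite e_irr.
have vS' : v \in S' by rewrite !inE nvu.
(* The vertices that become new neighbours of [v]. *)
pose M := [set x in S' :\ v | e x u && ~~ e x v].
have degu : (#|nbrs e S u| = #|M| + #|c| + 1)%N.
  rewrite (cardsD1 v) mem_nbrs vS uv addnC; congr (_ + _)%N.
  rewrite -(cardsID (nbrs e S v)) addnC; congr (_ + _)%N; apply: eq_card => x.
    rewrite !inE [e u x]e_sym [e v x]e_sym.
    have [->|nxu] := eqVneq x u; first by rewrite e_irr !andbF.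
    by case: (x \in S); case: (e x u); case: (e x v); rewrite ?andbF ?andbT.
  rewrite !inE; have [->|nxv] //= := eqVneq x v.
  by rewrite e_irr !andbF.
have edge x y : x \in S -> y \in S -> x != u -> y != u -> e x y -> e' x y.
  move=> xS yS nxu nyu xy; apply/contractP; split.
    by apply: contraTneq xy => ->; rewrite e_irr.
  by exists x, y; rewrite /fuse (negbTE nxu) (negbTE nyu).
have edge_u x : x \in S -> x != u -> x != v -> e x u -> e' x v.
  move=> xS nxu nxv xu; apply/contractP; split=> //.
  by exists x, u; rewrite /fuse (negbTE nxu) eqxx.
have e'_sym : symmetric e' by apply: contract_sym.
have deg_x x : x \in S' :\ v ->
    (#|nbrs e S' x| + (x \in M) <= #|nbrs e' S' x|)%N.
  rewrite !inE => /and3P[nxv nxu xS].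
  have sub : nbrs e S' x \subset nbrs e' S' x.
    apply/subsetP => y; rewrite !inE => /andP[/andP[nyu yS] xy].
    by rewrite nyu yS edge.
  have [/= /andP[xu nxv']|_] := boolP (e x u && ~~ e x v); last first.
    by rewrite !andbF addn0; apply: subset_leq_card.
  rewrite nxv nxu xS addn1; apply: proper_card; rewrite properE sub /=.
  apply/subsetPn; exists v; first by rewrite mem_nbrs vS' edge_u.
  by rewrite mem_nbrs (negbTE nxv') andbF.
have deg_v : (#|nbrs e S' v| + #|M| <= #|nbrs e' S' v|)%N.
  rewrite -cardsUI (_ : _ :&: M = set0) ?cards0 ?addn0; last first.
    apply/setP => x; rewrite !inE [e v x]e_sym.
    by case: (e x v); rewrite ?andbF.
  apply/subset_leq_card/subsetP => x; rewrite !inE.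
  case/orP => [/andP[/andP[nxu xS] vx]|/and3P[/and3P[nxv nxu xS] xu _]].
    by rewrite nxu xS edge.
  by rewrite nxu xS e'_sym edge_u.
have -> : (degree_sum e S' + (#|nbrs e S u|).*2 =
    (degree_sum e S' + #|M| + #|M|) + 2 + (#|c|).*2)%N.
  by rewrite degu -!addnn; lia.
rewrite !leq_add2r.
have D1 h : degree_sum h S' =
    #|nbrs h S' v| + \sum_(x in S' | x != v) #|nbrs h S' x|.
  by rewrite /degree_sum (bigD1 v).
rewrite !D1.
have EM : (#|M| = \sum_(x in S' | x != v) (x \in M))%N.
  rewrite -sum1_card big_mkcond [RHS]big_mkcond; apply: eq_bigr => x _ /=.
  rewrite !inE; case: (x == v); rewrite ?andbF ?andbT //=.
  by case: ((x != u) && (x \in S)) => //=; case: (_ && _).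
have : (\sum_(x in S' | x != v) (#|nbrs e S' x| + (x \in M)) <=
    \sum_(x in S' | x != v) #|nbrs e' S' x|)%N.
  by apply: leq_sum => x /andP[xS' nxv]; apply: deg_x; rewrite in_setD1 nxv.
by rewrite big_split /= -EM; lia.
Qed.

End EdgeBound.

Section EdgeBoundMain.
Variable T : finType.
Implicit Types (e : rel T) (S : {set T}).

(* Around a vertex of degree at most 5 whose edges all lie in at least three
   triangles, the neighbours form a clique or contain a K_{3,2}. *)
Lemma exists_light_edge e S v : minor_free e -> v \in S ->
  3 < #|nbrs e S v| <= 5 ->
  exists2 u, u \in nbrs e S v & #|nbrs e S u :&: nbrs e S v| <= 2.
Proof.
move=> mf vS /andP[d4 d5]; have [e_sym e_irr _ _] := mf.
have [/exists_inP[u uN le2]|] :=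
  boolP [exists u in nbrs e S v, #|nbrs e S u :&: nbrs e S v| <= 2].
  by exists u.
rewrite negb_exists_in => /forall_inP heavy; exfalso.
set N := nbrs e S v in d4 d5 heavy.
have vN x : x \in N -> e v x by rewrite mem_nbrs => /andP[].
have nvN x : x \in N -> v != x.
  by move=> /vN vx; apply: contraTneq vx => ->; rewrite e_irr.
have [cl|] := boolP [forall u in N, forall w in N, (u != w) ==> e u w].
  have {}cl u w : u \in N -> w \in N -> u != w -> e u w.
    by move/forall_inP: cl => h /h/forall_inP h' /h'/implyP.
  have sN : {subset enum N <= N} by move=> x; rewrite mem_enum.
  have uN := enum_uniq (mem N).
  have : 3 < size (enum N) by rewrite -cardE.
  case: (enum N) uN sN => [|a [|b [|c [|d l]]]] //= un sN _.
  have [aN bN cN dN] : [/\ a \in N, b \in N, c \in N & d \in N].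
    by split; apply: sN; rewrite !inE eqxx ?orbT.
  move: un; rewrite !inE !negb_or => /andP[/and4P[nab nac nad _]].
  case/andP => /and3P[nbc nbd _] /andP[/andP[ncd _] _].
  apply: (@K5_of_vertices _ e v a b c d mf) => /=.
    rewrite !inE !negb_or !nvN //.
    by rewrite nab nac nad nbc nbd ncd.
  by rewrite !vN // !cl.
rewrite negb_forall_in => /exists_inP[u uN].
rewrite negb_forall_in => /exists_inP[w wN]; rewrite negb_imply => /andP[nuw uw].
(* The nonadjacent u and w each have at least three neighbours in [N], all of them in [M], which has
   at most three elements. Hence both are joined to all of [M], as is v, and this is a K_{3,3}. *)
set M := N :\ u :\ w.
have M3 : #|M| <= 3.
  move: d5; rewrite (cardsD1 u N) uN (cardsD1 w (N :\ u)).
  by rewrite in_setD1 eq_sym nuw wN.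
have inM x y : x \in N -> y \in [set u; w] -> x \notin [set u; w] -> x \in M.
  by rewrite !in_setD1 !in_set2 negb_or => -> _ /andP[-> ->].
have full y : y \in [set u; w] -> {in M, forall x, e y x} /\ #|M| = 3.
  move=> yuw; have yN : y \in N by case/set2P: yuw => ->.
  have sub : nbrs e S y :&: N \subset M.
    apply/subsetP => x /setIP[]; rewrite mem_nbrs => /andP[_ yx] xN.
    apply: (inM _ y) => //; apply: contraL yx.
    by case/set2P: yuw => -> /set2P[]->; rewrite ?e_irr // e_sym.
  have h3 := heavy y yN; rewrite -ltnNge in h3.
  have eqM : nbrs e S y :&: N = M.
    by apply/eqP; rewrite eqEcard sub (leq_trans M3).
  split; last by apply: anti_leq; rewrite M3 -eqM.
  by move=> x; rewrite -eqM inE mem_nbrs => /andP[/andP[]].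
have [uM _] := full u (set21 _ _); have [wM M3'] := full w (set22 _ _).
have sM : {subset enum M <= M} by move=> x; rewrite mem_enum.
have unM := enum_uniq (mem M).
have : size (enum M) = 3 by rewrite -cardE.
case: (enum M) unM sM => [|a [|b [|c [|? ?]]]] //= un sM _.
have sub x : x \in [:: a; b; c] -> [/\ x \in N, x != u & x != w].
  by move/sM; rewrite !in_setD1 => /and3P[-> -> ->].
have [[aN au aw] [bN bu bw] [cN cu cw]] :
  [/\ [/\ a \in N, a != u & a != w], [/\ b \in N, b != u & b != w]
    & [/\ c \in N, c != u & c != w]].
  by split; apply: sub; rewrite !inE eqxx ?orbT.
apply: (@K33_of_vertices _ e u w v a b c mf) => /=.
  rewrite !inE !negb_or ![u == _]eq_sym ![w == _]eq_sym au bu cu aw bw cw.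
  by rewrite nuw !nvN //= andbT; move: un; rewrite !inE !negb_or andbT.
rewrite /allrel /= !vN //.
by rewrite !(uM, wM) //; apply: sM; rewrite !inE eqxx ?orbT.
Qed.

(** Deleting a vertex of degree at most 3, or contracting an edge whose ends have at most two common
    neighbours, lowers the degree sum by at most 6. *)
Lemma edge_bound e S : minor_free e -> 2 < #|S| ->
  degree_sum e S <= 6 * (#|S| - 2).
Proof.
move En : #|S| => n; elim: n e S En => // n IH e S En mf n3.
have [e_sym e_irr _ _] := mf.
have deg_lt u : u \in S -> #|nbrs e S u| <= n.
  move=> uS; rewrite -ltnS -En; apply: proper_card; apply/properP; split.
    by apply/subsetP => x; rewrite mem_nbrs => /andP[].
  by exists u => //; rewrite mem_nbrs e_irr andbF.
have [n2|n2] := leqP n 2.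
  have -> : n = 2 by lia.
  apply: (@leq_trans (\sum_(u in S) 2)); last by rewrite sum_nat_const En; lia.
  by apply: leq_sum => u uS; apply: leq_trans (deg_lt u uS) n2.
have /card_gt0P[v0 v0S] : 0 < #|S| by rewrite En.
pose v := [arg min_(x < v0 in S) #|nbrs e S x|].
have [vS vmin] : v \in S /\ {in S, forall x, #|nbrs e S v| <= #|nbrs e S x|}.
  by rewrite /v; case: arg_minnP.
have EnD u : u \in S -> #|S :\ u| = n.
  by move=> uS; move: En; rewrite (cardsD1 u) uS add1n => -[].
have ub := IH e (S :\ v) (EnD v vS) mf n2.
have dE := degree_sumD1 e_sym e_irr vS.
have lb : #|nbrs e S v| * n.+1 <= degree_sum e S.
  rewrite -En mulnC -sum_nat_const.
  exact: leq_sum.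
have [d3|d4] := leqP #|nbrs e S v| 3; first by lia.
(* Applied to S minus v, induction gives delta * (n - 1) <= 6 * (n - 2) for the minimum degree
   delta, hence delta < 6. *)
have d5 : #|nbrs e S v| <= 5 by nia.
have [|u] := @exists_light_edge e S v mf vS; first by rewrite d4.
rewrite mem_nbrs => /andP[uS vu] c2.
have uv : e u v by rewrite e_sym.
have h := degree_sum_fuse e_sym e_irr uS vS uv.
have mf' : minor_free (contract e S (fuse u v)).
  by apply: minor_free_contract => // i; apply: fuse_fiber_connected.
have := IH _ (S :\ u) (EnD u uS) mf' n2; lia.
Qed.

End EdgeBoundMain.

(** * Rooted triangles *)

Section RootedTriangle.
Variables (T : finType) (h : rel T) (A : {set T}).
Hypothesis h_sym : symmetric h.
Hypothesis biconnected : forall v, v \in A -> connected h (A :\ v).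

Lemma connected_path (a : T) (p : seq T) : path h a p ->
  connected h [set x in a :: p].
Proof.
elim: p a => [|b p IH] a /=.
  by move=> _; rewrite (_ : [set x in _] = [set a]) ?connected1 //;
     apply/setP => x; rewrite !inE.
case/andP => ab /IH cp.
rewrite (_ : [set x in _] = [set a] :|: [set x in b :: p]); last first.
  by apply/setP => x; rewrite !inE.
apply: connectedU => //; first exact: connected1.
by apply/adjacentP; exists a, b; rewrite !inE !eqxx.
Qed.

Lemma split_twice (P : pred T) (s : seq T) a b : a \in s -> b \in s ->
  a != b -> P a -> P b -> exists s1 s2, [/\ s = s1 ++ s2, has P s1 & has P s2].
Proof.
elim: s => [//|x s IH]; rewrite !inE => ha hb nab Pa Pb.
have [Px|nPx] := boolP (P x).
  exists [:: x], s; rewrite /= Px; split=> //; apply/hasP.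
  case/orP: ha hb => [/eqP ax|aS]; last by exists a.
  by case/orP => [/eqP bx|bS]; [rewrite ax bx eqxx in nab|exists b].
have neq y : P y -> y != x by apply: contraTneq => ->.
move: ha hb; rewrite (negbTE (neq a Pa)) (negbTE (neq b Pb)) /= => aS bS.
have [s1 [s2 [-> h1 h2]]] := IH aS bS nab Pa Pb.
by exists (x :: s1), s2; rewrite /= h1 orbT.
Qed.

(* Any three vertices of a 2-connected graph are the roots of a K3 minor: take
   a path from [c2] to [c3] avoiding [c1] and split it between two attachments
   of the component of [c1] off the path. *)
Lemma rooted_triangle c1 c2 c3 : c1 \in A -> c2 \in A -> c3 \in A ->
  c1 != c2 -> c1 != c3 -> c2 != c3 -> exists P1 P2 P3 : {set T},
  [/\ [/\ c1 \in P1, c2 \in P2 & c3 \in P3],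
      [/\ P1 \subset A, P2 \subset A & P3 \subset A],
      [/\ connected h P1, connected h P2 & connected h P3],
      [/\ [disjoint P1 & P2], [disjoint P1 & P3] & [disjoint P2 & P3]] &
      [/\ adjacent h P1 P2, adjacent h P1 P3 & adjacent h P2 P3]].
Proof.
move=> A1 A2 A3 n12 n13 n23.
have /connectedP/(_ c2 c3) := biconnected A1.
rewrite !in_setD1 eq_sym n12 eq_sym n13 A2 A3 => /(_ isT isT) /connectP[p0 pp0 lp0].
case/shortenP: pp0 lp0 => p pp up _ lp {p0}.
have [hp pA'] := restricted_path pp.
have {}pA' : all (mem (A :\ c1)) (c2 :: p) by apply: pA'; rewrite !inE eq_sym n12.
pose Q := [set x in c2 :: p].
have QA x : x \in Q -> x != c1 /\ x \in A.
  by rewrite inE => /(allP pA'); rewrite !inE => /andP[].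
have c3Q : c3 \in Q by rewrite inE lp mem_last.
have c2Q : c2 \in Q by rewrite inE mem_head.
pose K := component h (A :\: Q) c1.
have c1K : c1 \in K.
  apply: component_self; rewrite inE A1 andbT; apply/negP => /QA[].
  by rewrite eqxx.
have KQ x : x \in K -> x \in A /\ x \notin Q.
  by move=> /(subsetP (component_sub _ _ _)); rewrite inE => /andP[].
pose att := [pred q | [exists k in K, h k q]].
(* A walk from [c1] to another vertex of [Q] that avoids v leaves [K], necessarily at an attachment.
   Using this twice gives two distinct attachments. *)
have next v : v \in Q -> exists2 q, q \in Q & (q != v) && att q.
  move=> vQ; have [nv1 vA] := QA v vQ.
  have [z zQ nzv] : exists2 z, z \in Q & z != v.
    have [<-|n2v] := eqVneq c2 v; first by exists c3; rewrite // eq_sym.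
    by exists c2.
  have [_ zA] := QA z zQ.
  have /connectedP/(_ c1 z) := biconnected vA.
  rewrite !in_setD1 [c1 == v]eq_sym nv1 A1 nzv zA => /(_ isT isT) cz.
  have zK : z \notin K by apply/negP => /KQ[_]; rewrite zQ.
  have [k [y [_ kK yK /and3P[_ yAv ky] _]]] := connect_exit cz c1K zK.
  move: yAv; rewrite in_setD1 => /andP[nyv yA].
  exists y; last by rewrite nyv /=; apply/exists_inP; exists k.
  by apply: contraR yK => nyQ; apply: component_closed kK _ ky; rewrite inE nyQ.
have [a aQ /andP[_ ha]] := next c2 c2Q.
have [b bQ /andP[nba hb]] := next a aQ.
have [s1 [s2 [Es att1 att2]]] : exists s1 s2,
    [/\ c2 :: p = s1 ++ s2, has att s1 & has att s2].
  apply: (@split_twice att _ a b); rewrite 1?eq_sym //.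
    by move: aQ; rewrite inE.
  by move: bQ; rewrite inE.
case: s1 Es att1 => [//|x s1] [<- Ep] att1 {x}.
case: s2 Ep att2 => [//|y s2] Ep att2.
have {}up : uniq ((c2 :: s1) ++ y :: s2) by rewrite cat_cons -Ep.
move: hp lp; rewrite Ep cat_path /= last_cat /= => /and3P[hp1 hxy hp2] lp.
have sub1 x : x \in c2 :: s1 -> x \in Q.
  by rewrite in_set Ep -cat_cons mem_cat => ->.
have sub2 x : x \in y :: s2 -> x \in Q.
  by rewrite in_set Ep -cat_cons mem_cat => ->; rewrite orbT.
have adjK s : has att s -> adjacent h K [set x in s].
  case/hasP => x xs /exists_inP[k kK kx]; apply/adjacentP; exists k, x.
  by rewrite inE.
have disK s : {subset s <= Q} -> [disjoint K & [set x in s]].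
  move=> sQ; rewrite -setI_eq0; apply/eqP/setP => x; rewrite in_setI in_set0.
  by apply/negP => /andP[/KQ[_ /negP nx]]; rewrite inE => /sQ.
exists K, [set x in c2 :: s1], [set x in y :: s2]; split; split.
- by [].
- by rewrite inE mem_head.
- by rewrite inE lp mem_last.
- by apply/subsetP => x /KQ[].
- by apply/subsetP => x; rewrite inE => /sub1/QA[].
- by apply/subsetP => x; rewrite inE => /sub2/QA[].
- exact: connected_component.
- exact: connected_path.
- exact: connected_path.
- exact: disK.
- exact: disK.
- rewrite -setI_eq0; apply/eqP/setP => x; rewrite in_setI in_set0 !in_set.
  apply/negP => /andP[x1 x2]; move: up.
  rewrite cat_uniq => /and3P[_ /hasPn/(_ x x2)].
  by rewrite /= x1.
- exact: adjK.
- exact: adjK.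
apply/adjacentP; exists (last c2 s1), y.
by rewrite !in_set mem_last mem_head.
Qed.

End RootedTriangle.

(** * Owner blocks *)

Section Stars.
Variable T : finType.
Implicit Types (e : rel T) (U A B V L P : {set T}) (m : T -> T).

(** Owner assignments relative to a vertex set [U]. The dominating set is recovered as the fixed
    points of [m], so one map [m] serves on every side of every separation while only [e] and [U]
    change. *)
Definition star e U m := forall u, u \in U ->
  [/\ m u \in U, m (m u) = m u & m u != u -> e u (m u)].

Definition hubs U m := [set u in U | m u == u].

Definition outs e U m x := [set c in hubs U m |
  (c != m x) && [exists v in U, (m v == c) && e x v]].

(** The weight W of the part [U]; truncated subtraction plays the role of the positive part. *)
Definition excess e U m := \sum_(x in U | m x != x) (#|outs e U m x| - 2).

Lemma outsP e U m x c : reflect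
  [/\ c \in hubs U m, c != m x & exists v, [/\ v \in U, m v = c & e x v]]
  (c \in outs e U m x).
Proof.
rewrite [c \in outs _ _ _ _]in_set; apply: (iffP and3P) => -[cD nc].
  by move=> /exists_inP[v vU /andP[/eqP vc xv]]; split=> //; exists v.
case=> v [vU vc xv]; split=> //; apply/exists_inP; exists v => //.
by rewrite vc eqxx.
Qed.

Lemma outs_hubs e U m x : outs e U m x \subset hubs U m :\ m x.
Proof. by apply/subsetP => c /outsP[cD nc _]; rewrite in_setD1 nc. Qed.

(** [X] will be the set of straddling vertices and [k] the loss conceded at each of them. *)
Lemma excess_split e U m e1 U1 e2 U2 (X : {set T}) k :
  U1 \subset U -> U2 \subset U ->
  (forall x, x \in U -> m x != x -> #|outs e U m x| - 2 <=
    (x \in U1) * (#|outs e1 U1 m x| - 2) +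
    (x \in U2) * (#|outs e2 U2 m x| - 2) + k * (x \in X)) ->
  excess e U m <= excess e1 U1 m + excess e2 U2 m + k * #|X|.
Proof.
move=> sU1 sU2 le.
apply: (@leq_trans (\sum_(x in U | m x != x) (
    (x \in U1) * (#|outs e1 U1 m x| - 2) +
    (x \in U2) * (#|outs e2 U2 m x| - 2) + k * (x \in X)))).
  by apply: leq_sum => x /andP[xU nx]; apply: le.
have sumE (U' : {set T}) F : U' \subset U ->
    \sum_(x in U | m x != x) (x \in U') * F x = \sum_(x in U' | m x != x) F x.
  move=> /subsetP sU; rewrite big_mkcond [RHS]big_mkcond; apply: eq_bigr => x _.
  case: (boolP (x \in U')) => [/sU->|_]; first by rewrite mul1n.
  by rewrite mul0n; case: ifP.
rewrite !big_split /= !sumE // leq_add2l -big_distrr /= leq_mul2l.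
apply/orP; right; rewrite -sum1_card big_mkcond [leqRHS]big_mkcond.
by apply: leq_sum => x _; case: ifP; case: (x \in X).
Qed.

Lemma K33_of_sets e (X A B C : {set T}) : minor_free e -> 2 < #|X| ->
  connected e A -> connected e B -> connected e C ->
  [disjoint A & B] -> [disjoint A & C] -> [disjoint B & C] ->
  {in X, forall x, [/\ x \notin A, x \notin B & x \notin C]} ->
  {in X, forall x, [/\ adjacent e [set x] A, adjacent e [set x] B
                     & adjacent e [set x] C]} -> False.
Proof.
move=> [_ _ _ n33] /card_gt2P[x [y [z [[xX yX zX] [xy yz zx]]]]] cA cB cC.
move=> AB AC BC nin adj; apply: n33.
have [xA xB xC] := nin x xX; have [yA yB yC] := nin y yX.
have [zA zB zC] := nin z zX.
exists [:: [set x]; [set y]; [set z]], [:: A; B; C]; split=> //=.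
- by rewrite !connected1 cA cB cC.
- rewrite AB AC BC !disjoints1 xA xB xC yA yB yC zA zB zC !inE xy yz.
  by rewrite eq_sym zx.
rewrite /allrel /=.
by have [-> -> ->] := adj x xX; have [-> -> ->] := adj y yX;
   have [-> -> ->] := adj z zX.
Qed.

Section Star.
Variables (e : rel T) (U : {set T}) (m : T -> T).
Hypothesis mf : minor_free e.
Hypothesis st : star e U m.

Let e_sym : symmetric e. Proof. by case: mf. Qed.

Local Notation D := (hubs U m).
Local Notation h := (contract e U m).
Local Notation blocks := (preimage U m).
Local Notation C := (outs e U m).

Lemma hub_mem d : d \in D -> d \in U /\ m d = d.
Proof. by rewrite in_set => /andP[-> /eqP]. Qed.

Lemma owner_hub u : u \in U -> m u \in D.
Proof. by move=> /st[mU mm _]; rewrite in_set mU mm eqxx. Qed.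

Lemma star_adjacent u : u \in U -> m u != u -> adjacent e [set u] [set m u].
Proof.
move=> /st[_ _ h] /h uv; apply/adjacentP; exists u, (m u).
by rewrite !inE !eqxx.
Qed.

(** A block stays connected when vertices other than its hub are removed; [shared_outs] removes
    one. *)
Lemma star_connected d V : d \in V -> V \subset blocks [set d] -> connected e V.
Proof.
move=> dV /subsetP sV; apply: (connected_hook e_sym (connected1 e d)).
  by rewrite sub1set.
move=> v vV; exists d; rewrite ?inE //.
have := sV v vV; rewrite !inE => /andP[vU /eqP vd].
have [->|nvd] := eqVneq v d; first exact: connect0.
have [_ _] := st vU; rewrite vd eq_sym nvd => /(_ isT) evd.
by apply: connect1; rewrite restrictedE vV dV.
Qed.

Lemma block_connected i : connected e (blocks [set i]).
Proof.
apply/connectedP => a b ha hb; move: (ha); rewrite !inE => /andP[aU /eqP ai].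
have [iU ii _] := st aU; rewrite ai in iU ii.
have iV : i \in blocks [set i] by rewrite !inE iU ii eqxx.
by have /connectedP := star_connected iV (subxx _); apply.
Qed.

Lemma minor_free_quotient : minor_free h.
Proof. by apply: minor_free_contract => //; apply: block_connected. Qed.

Lemma quotient_sym : symmetric h.
Proof. exact: contract_sym. Qed.

Lemma blocks_connected A : connected h A -> connected e (blocks A).
Proof. by apply: connected_preimage => //; apply: block_connected. Qed.

Lemma outs_quotient x c : x \in U -> c \in C x -> h (m x) c.
Proof.
move=> xU /outsP[cD nc [v [vU vc xv]]]; apply/contractP; split.
  by rewrite eq_sym.
by exists x, v.
Qed.

Lemma adjacent_outs x A c : c \in C x -> c \in A ->
  adjacent e [set x] (blocks A).
Proof.
move=> /outsP[_ _ [v [vU vc xv]]] cA; apply/adjacentP; exists x, v.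
by rewrite !inE eqxx vU vc.
Qed.

Lemma outs_small x : #|D| <= 3 -> x \in U -> #|C x| - 2 = 0.
Proof.
move=> D3 xU; apply/eqP; rewrite subn_eq0.
apply: leq_trans (subset_leq_card (outs_hubs e U m x)) _.
by move: D3; rewrite (cardsD1 (m x)) owner_hub.
Qed.

Lemma excess_small : #|D| <= 3 -> excess e U m = 0.
Proof.
by move=> D3; apply: big1 => x /andP[xU _]; apply: outs_small.
Qed.

Section ThreeConnected.
Hypothesis D4 : 3 < #|D|.
Hypothesis conn3 : forall d c, d \in D -> c \in D -> d != c ->
  connected h (D :\ d :\ c).

(** If v were the only neighbour of d, deleting v and one further hub would cut d off from a fourth
    hub. *)
Lemma quotient_degree d : d \in D -> 1 < #|nbrs h D d|.
Proof.
move=> dD; rewrite ltnNge; apply/negP => N1.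
have [v [vD nvd Nv]] : exists v, [/\ v \in D, v != d & nbrs h D d \subset [set v]].
  have [N0|[v vN]] := set_0Vmem (nbrs h D d).
    have /card_gt0P[v] : 0 < #|D :\ d| by move: D4; rewrite (cardsD1 d) dD; lia.
    by rewrite in_setD1 => /andP[nvd vD]; exists v; rewrite N0 sub0set.
  exists v; move: (vN); rewrite mem_nbrs => /andP[vD dv]; split=> //.
    by apply: contraTneq dv => ->; rewrite contract_irr.
  have /eqP : #|nbrs h D d| = 1.
    by apply/eqP; rewrite eqn_leq N1; apply/card_gt0P; exists v.
  by move=> /cards1P[w Nw]; move: vN; rewrite Nw inE => /eqP->.
have /card_gt1P[x [y [xD yD nxy]]] : 1 < #|D :\ d :\ v|.
  move: D4; rewrite (cardsD1 d) dD (cardsD1 v (D :\ d)) in_setD1 nvd vD; lia.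
move: xD yD; rewrite !in_setD1 => /and3P[nxv nxd xD] /and3P[nyv nyd yD].
have /connectedP/(_ d y) := conn3 xD vD nxv.
rewrite !in_setD1 dD yD nyv [y == x]eq_sym nxy [d == x]eq_sym nxd.
rewrite [d == v]eq_sym nvd => /(_ isT isT) dy.
have ny : ~~ pred1 d y by rewrite /= nyd.
have [a [b [_ /eqP -> nb /and3P[_ + db] _]]] := connect_exit dy (eqxx d : pred1 d d) ny.
rewrite !in_setD1 => /and3P[nbv _ bD].
by have /(subsetP Nv) : b \in nbrs h D d; rewrite ?mem_nbrs ?bD // inE (negbTE nbv).
Qed.

(** The branch sets of the K_5 are {x}, the rest [Z] of the block of d, and the blocks over the
    three parts of a rooted triangle. [Z] is connected through its hub and contains the vertices
    that share the three blocks with x. *)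
Lemma shared_outs d (Y : {set T}) x : d \in D ->
  {in Y, forall y, [/\ y \in U, m y = d & y != d]} -> x \in Y ->
  #|C x :&: \bigcup_(y in Y :\ x) C y| <= 2.
Proof.
move=> dD Yd xY; rewrite leqNgt; apply/negP => /card_gt2P[c1 [c2 [c3 [[]]]]].
move=> /setIP[h1 /bigcupP[y1 Y1 y1c]] /setIP[h2 /bigcupP[y2 Y2 y2c]].
move=> /setIP[h3 /bigcupP[y3 Y3 y3c]] [n12 n23 n31].
have [xU xd nxd] := Yd x xY.
have inDd c : c \in C x -> c \in D :\ d.
  by move/(subsetP (outs_hubs _ _ _ _)); rewrite xd.
have [||||P1 [P2 [P3 [[m1 m2 m3] [s1 s2 s3] [k1 k2 k3] [d12 d13 d23]
    [a12 a13 a23]]]]] := @rooted_triangle T h (D :\ d) quotient_sym _ c1 c2 c3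
    (inDd _ h1) (inDd _ h2) (inDd _ h3).
- by move=> v; rewrite in_setD1 => /andP[nvd vD]; apply: conn3; rewrite // eq_sym.
- by [].
- by rewrite eq_sym.
- by [].
have dP (P : {set T}) : P \subset D :\ d -> d \notin P.
  by move=> /subsetP sP; apply/negP => /sP; rewrite in_setD1 eqxx.
pose Z := blocks [set d] :\ x.
have dZ : d \in Z.
  by have [dU dd] := hub_mem dD; rewrite !inE dU dd eq_sym nxd eqxx.
have disZ (P : {set T}) : P \subset D :\ d -> [disjoint Z & blocks P].
  move=> /dP dnP; rewrite -setI_eq0; apply/eqP/setP => z; rewrite !inE.
  by apply/negP => /andP[/and3P[_ _ /eqP ->] /andP[_]]; rewrite (negbTE dnP).
have disx (P : {set T}) : P \subset D :\ d -> [disjoint [set x] & blocks P].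
  by move=> /dP dnP; rewrite disjoints1 !inE xd (negbTE dnP) andbF.
have adjZ c y (P : {set T}) : y \in Y :\ x -> c \in C y -> c \in P ->
    adjacent e Z (blocks P).
  rewrite in_setD1 => /andP[nyx /Yd[yU yd _]] cy cP.
  by apply: adjacentS (adjacent_outs cy cP); rewrite ?sub1set // !inE yU yd eqxx nyx.
case: mf => _ _ n5 _; apply: n5.
exists [:: [set x]; Z; blocks P1; blocks P2; blocks P3]; split=> //=.
- rewrite connected1 !blocks_connected // (star_connected dZ) //.
  by apply: subsetDl.
have adjxZ : adjacent e [set x] Z.
  apply: adjacentS (star_adjacent xU _); rewrite ?xd // ?sub1set // eq_sym //.
rewrite !disx // !disZ // !disjoint_preimage // !adjacent_preimage //.
rewrite adjxZ (adjacent_outs h1) // (adjacent_outs h2) // (adjacent_outs h3) //.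
rewrite (adjZ c1 y1) // (adjZ c2 y2) // (adjZ c3 y3) // !andbT.
by rewrite disjoints1 !inE eqxx.
Qed.

(* Each [C x] shares at most two of its elements with the others, so its private
   elements pay for its excess; the total is two less than the degree because
   either two shared elements or two vertices [x] remain unused. *)
Lemma local_excess d : d \in D ->
  \sum_(x in U | (m x != x) && (m x == d)) (#|C x| - 2) + 2 <= #|nbrs h D d|.
Proof.
move=> dD; pose Y := [set x in U | [&& m x != x, m x == d & 2 < #|C x|]].
have Yd : {in Y, forall y, [/\ y \in U, m y = d & y != d]}.
  move=> y; rewrite inE => /and4P[yU ny /eqP yd _]; split=> //.
  by rewrite -yd eq_sym.
have Y3 : {in Y, forall y, 2 < #|C y|} by move=> y; rewrite inE => /and4P[].
have -> : \sum_(x in U | (m x != x) && (m x == d)) (#|C x| - 2) =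
    \sum_(x in Y) (#|C x| - 2).
  rewrite big_mkcond [RHS]big_mkcond; apply: eq_bigr => x _; rewrite !inE.
  case: (x \in U) => //=; case: (_ != _) => //=; case: (_ == _) => //=.
  by case: ltnP => // le; apply/eqP; rewrite subn_eq0.
set N := nbrs h D d.
have CN x : x \in Y -> C x \subset N.
  move=> /Yd[xU xd _]; apply/subsetP => c cx; rewrite mem_nbrs.
  by rewrite -xd outs_quotient // andbT; case/outsP: cx.
pose R x := C x :&: \bigcup_(y in Y :\ x) C y.
pose S := \bigcup_(x in Y) R x.
have R2 x : x \in Y -> #|R x| <= 2 by move=> xY; apply: (shared_outs dD Yd xY).
have RS x : x \in Y -> R x \subset S by move=> xY; apply: bigcup_sup.
have CE x : #|C x| = #|R x| + #|C x :\: R x|.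
  by rewrite -(cardsID (R x) (C x)) (setIidPr (subsetIl _ _)).
have SN : S \subset N.
  apply/bigcupsP => x xY; apply: subset_trans (CN x xY); exact: subsetIl.
have RE x y c : x \in Y -> y \in Y -> x != y -> c \in C x -> c \in C y -> c \in R x.
  move=> xY yY nxy cx cy; rewrite inE cx; apply/bigcupP; exists y => //.
  by rewrite in_setD1 eq_sym nxy.
(* An element outside [S] lies in at most one [C x], so the private parts are disjoint from each
   other and from [S]. *)
have count : #|S| + \sum_(x in Y) #|C x :\: R x| <= #|N|.
  have -> : \sum_(x in Y) #|C x :\: R x| =
      \sum_(c in N) \sum_(x in Y) (c \in C x :\: R x).
    rewrite exchange_big /=; apply: eq_bigr => x xY; rewrite -sum1_card.
    rewrite big_mkcond [RHS]big_mkcond; apply: eq_bigr => c _ /=.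
    case: ifP => [cx|_]; last by case: ifP.
    by rewrite (subsetP (CN x xY)) //; move: cx; rewrite in_setD => /andP[].
  rewrite -(cardsID S N) (setIidPr SN) leq_add2l -sum1_card big_mkcond /=.
  rewrite [leqRHS]big_mkcond; apply: leq_sum => c _; case: ifP => // cN.
  have [/exists_inP[x xY cx]|/exists_inPn none] :=
    boolP [exists x in Y, c \in C x :\: R x]; last first.
    by rewrite big1 // => x /none/negbTE->.
  move: cx; rewrite in_setD => /andP[ncR cx].
  have -> : c \in N :\: S.
    rewrite in_setD cN andbT; apply/bigcupP => -[y yY cRy].
    have [xy|nxy] := eqVneq x y; first by rewrite xy cRy in ncR.
    case/negP: ncR; apply: (RE x y) => //.
    by move: cRy; rewrite inE => /andP[].
  rewrite (bigD1 x) //= big1 ?addn0; first by case: (_ \in _).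
  move=> y /andP[yY nyx]; rewrite in_setD.
  have [cy|//] := boolP (c \in C y); last by rewrite andbF.
  by case/negP: ncR; apply: (RE x y); rewrite // eq_sym.
have [S2|S1] := leqP 2 #|S|.
  have : \sum_(x in Y) (#|C x| - 2) <= \sum_(x in Y) #|C x :\: R x|.
    by apply: leq_sum => x xY; have := R2 x xY; rewrite CE; lia.
  lia.
(* Now each [R x] has at most one element, so every x in [Y] has a private element to spare and two
   such x pay for the constant 2. With one x the bound is |C x| <= |N|, and with none it is
   [quotient_degree]. *)
have : \sum_(x in Y) (#|C x| - 2) + #|Y| <= \sum_(x in Y) #|C x :\: R x|.
  rewrite -sum1_card -big_split /=; apply: leq_sum => x xY.
  have := subset_leq_card (RS x xY); have := Y3 x xY; rewrite CE; lia.
have := subset_leq_card SN.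
have [Y2|Y1] := leqP 2 #|Y|; first by lia.
have [->|[x xY]] := set_0Vmem Y.
  by rewrite big_set0 add0n => *; apply: quotient_degree.
have Yx : Y = [set x].
  by apply/eqP; rewrite eq_sym eqEcard sub1set xY cards1 -ltnS.
rewrite Yx big_set1 => _ _; have := subset_leq_card (CN x xY).
have := Y3 x xY; lia.
Qed.

Lemma excess_three_connected : excess e U m <= 4 * (#|D| - 3).
Proof.
have eb := edge_bound minor_free_quotient (ltnW D4).
have : excess e U m + 2 * #|D| <= degree_sum h D.
  rewrite /excess (partition_big m (mem D)) /=; last first.
    by move=> x /andP[xU _]; apply: owner_hub.
  rewrite mulnC -sum_nat_const -big_split /=; apply: leq_sum => d dD.
  apply: leq_trans (local_excess dD); rewrite leq_add2r.
  by apply: eq_leq; apply: eq_bigl => x; rewrite andbA.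
by move: eb; lia.
Qed.

End ThreeConnected.

Lemma star_sub A : A \subset D -> star e (blocks A) m /\ hubs (blocks A) m = A.
Proof.
move=> /subsetP sA; split=> [u|].
  rewrite inE => /andP[uU uA]; have [mU mm ea] := st uU.
  by split=> //; rewrite inE mU mm.
apply/setP => d; rewrite !inE; apply/andP/idP => [[/andP[_ dA] /eqP <-]//|dA].
by have [dU dd] := hub_mem (sA d dA); rewrite dU dd dA.
Qed.

Definition straddlers d L P := [set x in U |
  [&& m x == d, x != d, C x :&: L != set0 & C x :&: P != set0]].

Lemma straddlersP d L P x : reflect
  [/\ x \in U, m x = d, x != d, C x :&: L != set0 & C x :&: P != set0]
  (x \in straddlers d L P).
Proof.
rewrite in_set; apply: (iffP and5P); first by case=> ? /eqP.
by case=> ? -> *; split.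
Qed.

Definition separated L P := [forall x in L, forall y in P, ~~ h x y].

Lemma separatedP L P : reflect {in L & P, forall x y, h x y = false}
  (separated L P).
Proof.
apply: (iffP forall_inP) => [s x y xL yP|s x xL].
  by apply/negbTE; move: y yP; apply/forall_inP: (s x xL).
by apply/forall_inP => y yP; rewrite s.
Qed.

Lemma connect_separated L B a b : separated L (B :\: L) ->
  connect (restricted h B) a b -> a \in L -> b \in L.
Proof.
move=> /separatedP sep ab aL; have [//|nbL] := boolP (b \in L).
have [x [y [_ xL yL /and3P[_ yB xy] _]]] := connect_exit ab aL nbL.
by rewrite sep // in xy; rewrite in_setD yL.
Qed.

Lemma connect_blocks A V v w : connected h A -> blocks A \subset V ->
  v \in blocks A -> w \in blocks A -> connect (restricted e V) v w.
Proof.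
move=> /blocks_connected/connectedP cA sV vA wA.
exact: connect_restrictedS sV (cA v w vA wA).
Qed.

Lemma outs_nonempty x A : C x :&: A != set0 -> exists2 c, c \in C x & c \in A.
Proof. by case/set0Pn => c /setIP[]; exists c. Qed.

(* [L] is maximal such that it is joined together without using the straddling
   vertices; then a straddling vertex meets every component of the rest, and
   three of them would give a K_{3,3}. *)
Lemma one_separation d : d \in D -> ~~ connected h (D :\ d) -> exists L,
  [/\ L \subset D :\ d, L != set0, D :\ d :\: L != set0,
      separated L (D :\ d :\: L) &
      #|straddlers d L (D :\ d :\: L)| <= 2].
Proof.
move=> dD; set B := D :\ d.
rewrite negb_forall_in => /exists_inP[a aB]; rewrite negb_forall_in.
move=> /exists_inP[b bB nab].
(* [K L] also takes the vertices of the block of d that see blocks of [L] only. None of them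
   straddles, so they may help to connect [L]. *)
pose K L := blocks L :|:
  [set x in U | [&& m x == d, x != d, C x != set0 & C x \subset L]].
pose good L := [&& L \subset B, L != set0, B :\: L != set0,
  separated L (B :\: L) & connected e (K L)].
have dNB : d \notin B by rewrite in_setD1 eqxx.
have CB x : m x = d -> C x \subset B.
  by move=> xd; have := outs_hubs e U m x; rewrite xd.
have inK L x : reflect
    (x \in U /\ (m x \in L \/ [/\ m x = d, x != d, C x != set0 & C x \subset L]))
    (x \in K L).
  rewrite in_setU [x \in blocks L]in_set [x \in finset _]in_set -andb_orr.
  apply: (iffP andP) => -[xU h1]; split=> //.
    by case/orP: h1 => [|/and4P[/eqP]]; [left|right].
  by case: h1 => [->//|[-> -> -> ->]]; rewrite eqxx orbT.
pose L0 := component h B a.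
have good0 : good L0.
  have sL0 : L0 \subset B := component_sub _ _ _.
  apply/and5P; split=> //.
  - by apply/set0Pn; exists a; apply: component_self.
  - by apply/set0Pn; exists b; rewrite in_setD bB in_set bB (negbTE nab).
  - apply/separatedP => x y xL; rewrite in_setD => /andP[yL yB].
    by apply: contraNF yL; apply: component_closed.
  have cL0 : connected h L0 := connected_component quotient_sym _ _.
  have sub : blocks L0 \subset K L0 := subsetUl _ _.
  apply: (connected_hook e_sym (blocks_connected cL0) sub) => x xK.
  have [xU [xL|[xd nxd Cx0 sCx]]] := inK _ _ xK.
    by exists x; [rewrite in_set xU | apply: connect0].
  have /set0Pn[c cx] := Cx0; have [_ _ [v [vU vc xv]]] := outsP _ _ _ _ _ cx.
  have vb : v \in blocks L0 by rewrite in_set vU vc (subsetP sCx).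
  exists v => //; apply: connect1.
  by rewrite restrictedE xK (subsetP sub).
have [L /maxsetP[/and5P[sL L0' P0 sep cK] maxL] _] := maxset_exists good0.
exists L; split=> //; set P := B :\: L.
pose reach x := [set c' in B | [exists c in C x, connect (restricted h B) c c']].
have inR x c : (c \in reach x) =
    (c \in B) && [exists c' in C x, connect (restricted h B) c' c].
  by rewrite in_set.
have sub_reach x : m x = d -> C x \subset reach x.
  move=> xd; apply/subsetP => c cx; rewrite in_set (subsetP (CB x xd)) //=.
  by apply/exists_inP; exists c; rewrite ?connect0.
(* Otherwise [L] together with all components seen by x would again be good: x sees nothing outside
   this larger set, so it enters [K] and links those components to [L], against maximality. *)
have full x : x \in straddlers d L P -> P \subset reach x.
  move=> /straddlersP[xU xd nxd /outs_nonempty[c1 h1 c1L] /outs_nonempty[c2 h2 c2P]].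
  pose L' := L :|: reach x.
  have sL' : L' \subset B.
    by rewrite subUset sL; apply/subsetP => c; rewrite inR => /andP[].
  have c2L' : c2 \in L' by rewrite in_setU (subsetP (sub_reach x xd)) ?orbT.
  have [/eqP B0|nB0] := boolP (B :\: L' == set0).
    apply/subsetP => p; rewrite in_setD => /andP[pL pB].
    have : p \notin B :\: L' by rewrite B0 in_set0.
    by rewrite in_setD pB andbT negbK in_setU (negbTE pL).
  suff good' : good L'.
    have := maxL _ good' (subsetUl _ _) => E; move: c2L'; rewrite E.
    by move: c2P; rewrite in_setD => /andP[/negbTE->].
  apply/and5P; split=> //.
  - by apply/set0Pn; exists c2.
  - apply/separatedP => y z; rewrite in_setU => yL; rewrite in_setD => /andP[zL' zB].
    apply: contraNF zL' => yz; rewrite in_setU.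
    case/orP: yL => [yL|].
      apply/orP; left; apply: contraT => zL; move: yz.
      by rewrite (separatedP _ _ sep y z yL) // in_setD zL.
    rewrite !inR => /andP[yB /exists_inP[c cx cy]]; apply/orP; right.
    rewrite zB; apply/exists_inP; exists c => //; apply: connect_trans cy _.
    by apply: connect1; rewrite restrictedE yB zB.
  have subK : K L \subset K L'.
    apply/subsetP => y /inK[yU hy]; apply/inK; split=> //.
    case: hy => [yL|[? ? ? sy]]; [left|right]; first by rewrite in_setU yL.
    by split=> //; apply: subset_trans sy (subsetUl _ _).
  have xK : x \in K L'.
    apply/inK; split=> //; right; split=> //; first by apply/set0Pn; exists c1.
    exact: subset_trans (sub_reach x xd) (subsetUr _ _).
  have [_ _ [v1 [v1U v1c xv1]]] := outsP _ _ _ _ _ h1.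
  have v1K : v1 \in K L by apply/inK; split=> //; left; rewrite v1c.
  have v1K' := subsetP subK _ v1K.
  have xv : connect (restricted e (K L')) x v1.
    by apply: connect1; rewrite restrictedE xK v1K'.
  have toL y : y \in U -> m y \in L' ->
      exists2 z, z \in K L & connect (restricted e (K L')) y z.
    move=> yU; rewrite in_setU => /orP[yL|].
      by exists y; [apply/inK; split=> //; left | apply: connect0].
    rewrite inR => /andP[yB /exists_inP[c cx cy]].
    have [_ _ [w [wU wc xw]]] := outsP _ _ _ _ _ cx.
    have cB : c \in B by apply: subsetP cx; apply: CB.
    exists v1 => //; apply: connect_trans xv.
    have wK : w \in K L'.
      apply/inK; split=> //; left; rewrite wc in_setU.
      by rewrite (subsetP (sub_reach x xd)) ?orbT.
    apply: (@connect_trans _ _ w); last first.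
      by apply: connect1; rewrite restrictedE xK wK e_sym.
    apply: (@connect_blocks (component h B c)).
    - exact: (connected_component quotient_sym).
    - apply/subsetP => z; rewrite in_set => /andP[zU]; rewrite in_set => /andP[zB cz].
      apply/inK; split=> //; left; rewrite in_setU inR zB; apply/orP; right.
      by apply/exists_inP; exists c.
    - by rewrite in_set yU in_set yB.
    - by rewrite in_set wU wc in_set cB connect0.
  apply: (connected_hook e_sym cK subK) => y yK.
  have [yU [yL|[yd nyd Cy0 sCy]]] := inK _ _ yK; first exact: toL.
  have /set0Pn[c cy] := Cy0; have [_ _ [w [wU wc yw]]] := outsP _ _ _ _ _ cy.
  have wL : m w \in L' by rewrite wc (subsetP sCy).
  have [z zK wz] := toL w wU wL; exists z => //.
  apply: connect_trans wz; apply: connect1; rewrite restrictedE yK yw andbT.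
  by apply/inK; split=> //; left.
rewrite leqNgt; apply/negP => S3.
have /set0Pn[p pP] := P0; have pB : p \in B by move: pP; rewrite in_setD => /andP[].
(* One side of the K_{3,3} consists of [K L], a single component [Q] of the rest, and the hub d
   alone; by [full] every straddling vertex is adjacent to all three. *)
pose Q := component h B p.
have QL q : q \in Q -> q \notin L.
  rewrite in_set => /andP[qB pq]; apply/negP => qL.
  rewrite (restricted_sym quotient_sym) in pq.
  have := connect_separated sep pq qL.
  by move: pP; rewrite in_setD => /andP[/negbTE->].
have dL : d \notin L by apply: contra dNB; apply: (subsetP sL).
have dQ : d \notin Q by apply: contra dNB => /(subsetP (component_sub _ _ _)).
have [dU dd] := hub_mem dD.
apply: (@K33_of_sets e (straddlers d L P) (K L) (blocks Q) [set d] mf S3 cK).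
- exact/blocks_connected/(connected_component quotient_sym).
- exact: connected1.
- rewrite -setI_eq0; apply/eqP/setP => y; rewrite in_setI in_set0.
  apply/negP => /andP[/inK[_ hy]]; rewrite in_set => /andP[_ yQ].
  by case: hy => [yL|[yd _ _ _]]; [case/negP: (QL _ yQ) | case/negP: dQ; rewrite -yd].
- rewrite disjoint_sym disjoints1; apply/inK => -[_].
  by rewrite dd => -[|[_]]; [apply/negP | rewrite eqxx].
- by rewrite disjoint_sym disjoints1 in_set dd (negbTE dQ) andbF.
- move=> x /straddlersP[xU xd nxd _ /outs_nonempty[c cx cP]]; split.
  + apply/inK => -[_]; rewrite xd => -[|[_ _ _ /subsetP/(_ c cx)]]; first exact/negP.
    by move: cP; rewrite in_setD => /andP[/negbTE->].
  + by rewrite in_set xd (negbTE dQ) andbF.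
  + by rewrite in_set1.
move=> x xS; have [xU xd nxd /outs_nonempty[c cx cL] _] := straddlersP _ _ _ _ xS.
split.
- by apply: adjacentS (adjacent_outs cx cL); rewrite ?subsetUl.
- have := subsetP (full x xS) p pP; rewrite inR => /andP[_ /exists_inP[c' c'x c'p]].
  apply: (adjacent_outs c'x); rewrite in_set (subsetP (CB x xd)) //=.
  by rewrite (restricted_sym quotient_sym).
by rewrite -xd; apply: star_adjacent => //; rewrite xd eq_sym.
Qed.

(** [P] is a union of components of [B] minus c, and each of them is attached to c because [B] is
    connected. *)
Lemma connected_attach B P c : connected h B -> c \in B -> P \subset B :\ c ->
  separated P (B :\ c :\: P) -> connected h (c |: P).
Proof.
move=> /connectedP cB cinB sP /separatedP sep.
apply: (connected_hook quotient_sym (connected1 h c) (subsetUl _ _)) => v vV.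
exists c; first by rewrite in_set1.
set V := c |: P in vV *; pose W := component h V v.
have vW : v \in W by apply: component_self.
have [|nc] := boolP (c \in W); first by rewrite in_set => /andP[].
have vB : v \in B.
  case/setU1P: vV => [->//|/(subsetP sP)]; by rewrite in_setD1 => /andP[].
have [x [y [_ xW yW /and3P[_ yB xy] _]]] := connect_exit (cB v c vB cinB) vW nc.
have xV : x \in V by apply: subsetP xW; apply: component_sub.
have xP : x \in P.
  move: xV; rewrite in_setU1 => /orP[/eqP xc|//].
  by case/negP: nc; rewrite -xc.
have yV : y \notin V by apply: contra yW => yV; apply: component_closed xW yV xy.
move: yV; rewrite in_setU1 negb_or => /andP[nyc yP].
by rewrite sep // in xy; rewrite in_setD yP in_setD1 nyc.
Qed.

(** The blocks of [P] are not collapsed to one vertex: each component of their union goes onto a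
    neighbouring vertex of the block of c. The vertices of all other blocks keep their names and
    owners. *)
Lemma retraction P c : c \in D -> c \notin P -> connected h (c |: P) ->
  exists f : T -> T, [/\ {in blocks P, forall u, f u \in blocks [set c]},
    forall u, u \notin blocks P -> f u = u &
    forall i, connected e (preimage U f [set i])].
Proof.
move=> cD cP conn; have [cU cc] := hub_mem cD.
pose hit u := [pred i in blocks [set c] |
  [exists a, connect (restricted e (blocks P)) u a && e a i]].
(* On the blocks of [P] the default of [odflt] is never taken, as the proof of [hitP] shows. *)
pose f u := if u \in blocks P then odflt u [pick i | hit u i] else u.
have cbc : c \in blocks [set c] by rewrite in_set cU cc in_set1 eqxx.
have hitP u : u \in blocks P -> hit u (f u).
  move=> uP; rewrite /f uP; case: pickP => [//|none]; exfalso.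
  have sP : blocks P \subset blocks (c |: P) := preimageS _ _ (subsetUr _ _).
  have /connectedP/(_ u c) := blocks_connected conn.
  rewrite (subsetP sP) // (subsetP (preimageS _ _ (subsetUl _ _)) _ cbc).
  move=> /(_ isT isT) uc.
  have cNP : c \notin blocks P by rewrite in_set cc negb_and cP orbT.
  have [x [y [ux xP yP /and3P[_ yV xy] _]]] := connect_exit uc uP cNP.
  have /negP := none y; apply; apply/andP; split.
    have [yU yc] : y \in U /\ m y \in c |: P by move: yV; rewrite in_set => /andP.
    have {}yP : y \notin blocks P := yP.
    have {}yP : m y \notin P by apply: contra yP => h; rewrite in_set yU.
    by case/setU1P: yc yP => [yc _|->//]; rewrite in_set yU yc in_set1 eqxx.
  apply/existsP; exists x; rewrite xy andbT; apply: connect_restrictedS ux.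
  by apply/subsetP => z /setIP[_]; rewrite in_set.
exists f; split=> [u /hitP/andP[]//|u /negbTE uP|i]; first by rewrite /f uP.
(* [pick] depends only on the extension of the predicate, which is the same throughout a component.
   So [f] is constant on components, which makes its fibers connected. *)
have fE u v : u \in blocks P -> connect (restricted e (blocks P)) u v -> f v = f u.
  move=> uP uv; rewrite /f uP (connect_restricted_in uv uP).
  have hitE : hit v =1 hit u.
    move=> j; congr (_ && _); apply: eq_existsb => a; congr (_ && _).
    by rewrite (same_connect (restricted_sym e_sym _) uv).
  rewrite (eq_pick hitE); case: pickP => // none.
  by have := hitP u uP; rewrite none.
have hook u : u \in preimage U f [set i] -> u \in blocks P ->
    i \in preimage U f [set i] /\ connect (restricted e (preimage U f [set i])) u i.
  rewrite in_set in_set1 => /andP[uU /eqP ui] uP.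
  have := hitP u uP; rewrite ui => /andP[ic /existsP[a /andP[ua ai]]].
  have iP : i \notin blocks P.
    move: ic; rewrite in_set => /andP[_ /set1P ic].
    by rewrite in_set ic (negbTE cP) andbF.
  have iF : i \in preimage U f [set i].
    rewrite in_set in_set1 /f (negbTE iP) eqxx andbT.
    by move: ic; rewrite in_set => /andP[].
  split=> //; have sub : component e (blocks P) u \subset preimage U f [set i].
    apply/subsetP => v; rewrite in_set => /andP[vP uv].
    by rewrite in_set in_set1 (fE u) // ui eqxx; move: vP; rewrite in_set => /andP[->].
  have aC : a \in component e (blocks P) u.
    by rewrite in_set ua (connect_restricted_in ua).
  apply: (@connect_trans _ _ a).
    have /connectedP cC := connected_component e_sym (blocks P) u.
    exact: connect_restrictedS sub (cC u a (component_self _ uP) aC).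
  by apply: connect1; rewrite restrictedE (subsetP sub) // iF.
apply/connectedP => a b aF bF.
have toi u : u \in preimage U f [set i] ->
    connect (restricted e (preimage U f [set i])) u i.
  move=> uF; have [uP|uP] := boolP (u \in blocks P); first by case: (hook u uF uP).
  by move: uF; rewrite in_set in_set1 /f (negbTE uP) => /andP[_ /eqP->].
apply: connect_trans (toi a aF) _; rewrite (restricted_sym e_sym).
exact: toi.
Qed.

Lemma outs_sub A x : A \subset D -> C x :&: A \subset outs e (blocks A) m x.
Proof.
move=> sA; apply/subsetP => c /setIP[/outsP[cD nc [v [vU vc xv]]] cA].
have [_ hE] := star_sub sA; apply/outsP; rewrite hE; split=> //.
by exists v; rewrite in_set vU vc.
Qed.

(* One side of a 2-separation: the blocks of [P] are merged into that of [c]. *)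
Lemma contracted_side d c P : d \in D -> c \in D -> d != c ->
  P \subset D :\ d :\ c -> connected h (c |: P) -> exists e' : rel T,
  [/\ minor_free e', star e' (blocks (D :\: P)) m,
      {in blocks (D :\: P), forall x,
        C x :&: (D :\: P) \subset outs e' (blocks (D :\: P)) m x} &
      {in blocks (D :\: P), forall x, m x = d -> C x :&: P != set0 ->
        c \in outs e' (blocks (D :\: P)) m x}].
Proof.
move=> dD cD ndc sP conn; set A := D :\: P.
have cP : c \notin P by apply/negP => /(subsetP sP); rewrite in_setD1 eqxx.
have sA : A \subset D := subsetDl _ _.
have [stA hA] := star_sub sA; have cA : c \in A by rewrite in_setD cP cD.
have [f [fP fid fconn]] := retraction cD cP conn.
exists (contract e U f).
have nP x : m x \in A -> f x = x.
  by rewrite in_setD => /andP[nxP _]; apply: fid; rewrite in_set (negbTE nxP) andbF.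
have memA x : x \in blocks A -> x \in U /\ m x \in A by rewrite in_set => /andP[].
split.
- exact: minor_free_contract.
- move=> u ub; have [mb mm ea] := stA u ub; split=> // nmu.
  have [uU uA] := memA u ub; have [mU _] := memA _ mb.
  apply/contractP; split; first by rewrite eq_sym.
  by exists u, (m u); rewrite !nP ?mm //; split=> //; apply: ea.
- move=> x xb; have [xU xA] := memA x xb.
  apply/subsetP => b /setIP[/outsP[bD nb [v [vU vb xv]]] bA].
  apply/outsP; rewrite hA; split=> //; exists v; rewrite in_set vU vb; split=> //.
  apply/contractP; split; first by apply: contraNneq nb => ->; rewrite vb.
  by exists x, v; rewrite !nP ?vb.
move=> x xb xd /outs_nonempty[b /outsP[_ _ [v [vU vb xv]]] bP].
have [xU xA] := memA x xb.
have : f v \in blocks [set c] by apply: fP; rewrite in_set vU vb.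
rewrite in_set in_set1 => /andP[fvU /eqP fvc].
apply/outsP; rewrite hA xd eq_sym; split=> //; exists (f v).
rewrite in_set fvU fvc; split=> //; apply/contractP; split.
  by apply: contra_neq ndc => xf; rewrite -xd xf fvc.
by exists x, v; rewrite (nP x).
Qed.

(** [P] may be disconnected; [Q] is [P] joined up by the other hub of the cut, which still avoids d.
    Three straddling vertices against the blocks of [L], the blocks of [Q] and the hub d would form
    a K_{3,3}. *)
Lemma straddlers_bound d L P (Q : {set T}) : d \in D -> d \notin L -> d \notin Q ->
  P \subset Q -> connected h L -> connected h Q -> [disjoint L & Q] ->
  #|straddlers d L P| <= 2.
Proof.
move=> dD dL dQ sPQ cL cQ dLQ; rewrite leqNgt; apply/negP => S3.
have [dU dd] := hub_mem dD.
apply: (@K33_of_sets e (straddlers d L P) (blocks L) (blocks Q) [set d] mf S3).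
- exact: blocks_connected.
- exact: blocks_connected.
- exact: connected1.
- exact: disjoint_preimage.
- by rewrite disjoint_sym disjoints1 in_set dd (negbTE dL) andbF.
- by rewrite disjoint_sym disjoints1 in_set dd (negbTE dQ) andbF.
- move=> x /straddlersP[xU xd nxd _ _].
  by rewrite !in_set in_set1 xd (negbTE dL) (negbTE dQ) !andbF.
move=> x /straddlersP[xU xd nxd].
move=> /outs_nonempty[c cx cL'] /outs_nonempty[c' c'x c'P]; split.
- exact: adjacent_outs cx cL'.
- exact: adjacent_outs c'x (subsetP sPQ _ c'P).
by rewrite -xd; apply: star_adjacent => //; rewrite xd eq_sym.
Qed.

(** One component [L] is enough here: as neither d nor c alone disconnects the quotient, every
    component of the rest is attached to both of them. *)
Lemma two_separation d c : d \in D -> c \in D -> d != c ->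
  connected h (D :\ d) -> connected h (D :\ c) ->
  ~~ connected h (D :\ d :\ c) -> exists L P,
  [/\ L :|: P = D :\ d :\ c, [disjoint L & P], L != set0, P != set0 &
      separated L P] /\
  [/\ connected h (c |: P), connected h (d |: L),
      #|straddlers d L P| <= 2 & #|straddlers c L P| <= 2].
Proof.
move=> dD cD ndc conn_d conn_c; set B := D :\ d :\ c.
have BC : D :\ c :\ d = B by apply/setP => x; rewrite !in_setD1 andbCA.
rewrite negb_forall_in => /exists_inP[a aB]; rewrite negb_forall_in.
move=> /exists_inP[b bB nab]; pose L := component h B a; pose P := B :\: L.
have sL : L \subset B := component_sub _ _ _.
have sP : P \subset B := subsetDl _ _.
have BP : B :\: P = L by rewrite setDDr setDv set0U (setIidPr sL).
have cB : c \notin B by rewrite in_setD1 eqxx.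
have dB : d \notin B by rewrite in_setD1 in_setD1 eqxx andbF.
have sep : separated L P.
  apply/separatedP => x y xL; rewrite in_setD => /andP[yL yB].
  by apply: contraNF yL; apply: component_closed.
have sepC : separated P L.
  by apply/separatedP => x y xP yL; rewrite quotient_sym (separatedP _ _ sep).
have dL : [disjoint L & P].
  rewrite -setI_eq0; apply/eqP/setP => x; rewrite in_setI in_setD in_set0.
  by case: (x \in L).
have conn_cP : connected h (c |: P).
  by apply: connected_attach conn_d _ sP _; rewrite -/B ?BP // in_setD1 eq_sym ndc.
have conn_dP : connected h (d |: P).
  by apply: connected_attach conn_c _ _ _; rewrite ?BC ?BP // in_setD1 ndc.
have conn_dL : connected h (d |: L).
  by apply: connected_attach conn_c _ _ _; rewrite ?BC // in_setD1 ndc.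
have nL x : x \notin B -> x \notin L by apply: contra; apply: (subsetP sL).
have nP x : x \notin B -> x \notin P by apply: contra; apply: (subsetP sP).
have conn_L : connected h L := connected_component quotient_sym _ _.
have disU x : x \notin B -> [disjoint L & x |: P].
  move=> xB; rewrite -setI_eq0 setIUr setU_eq0 !setI_eq0 dL andbT.
  by rewrite disjoint_sym disjoints1 nL.
exists L, P; split; split=> //.
- by rewrite -{1}(setIidPr sL) setID.
- by apply/set0Pn; exists a; apply: component_self.
- by apply/set0Pn; exists b; rewrite in_setD bB in_set bB (negbTE nab).
- apply: (straddlers_bound dD (nL d dB) _ (subsetUr [set c] P) conn_L conn_cP).
    by rewrite in_setU1 negb_or ndc nP.
  exact: disU.
apply: (straddlers_bound cD (nL c cB) _ (subsetUr [set d] P) conn_L conn_dP).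
  by rewrite in_setU1 negb_or eq_sym ndc nP.
exact: disU.
Qed.

End Star.

(** * Induction on the number of blocks *)

(** The merged hub c gives [O1] one element beyond [A :&: L]. If c already belongs to [A], it is
    counted on both sides, so the gain remains. *)
Lemma card_straddle (A O1 O2 L : {set T}) c : A :&: L \subset O1 -> c \in O1 ->
  c \notin L -> A :\: L \subset O2 -> #|A| < #|O1| + #|O2|.
Proof.
move=> s1 cO cL s2; rewrite -(cardsID L A) -addSn; apply: leq_add.
  rewrite (cardsD1 c O1) cO add1n ltnS; apply: subset_leq_card.
  apply/subsetP => x xA; rewrite in_setD1 (subsetP s1) // andbT.
  by apply: contraNneq cL => <-; case/setIP: xA.
exact: subset_leq_card.
Qed.

(** A vertex whose outside blocks all survive on one side loses nothing; the booleans are its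
    memberships as they occur in [excess_split]. *)
Lemma pay_left (a b : bool) o o1 o2 k : o <= o1 -> a ->
  o - 2 <= a * (o1 - 2) + b * (o2 - 2) + k.
Proof.
move=> le ->; rewrite mul1n -addnA.
exact: leq_trans (leq_sub2r 2 le) (leq_addr _ _).
Qed.

Lemma pay_right (a b : bool) o o1 o2 k : o <= o2 -> b ->
  o - 2 <= a * (o1 - 2) + b * (o2 - 2) + k.
Proof. by rewrite [X in X + k]addnC; apply: pay_left. Qed.

Lemma separatedC e U m L P : symmetric e -> separated e U m L P ->
  separated e U m P L.
Proof.
move=> e_sym /separatedP s; apply/separatedP => x y xP yL.
by rewrite contract_sym // s.
Qed.

(** Both [e] and [U] vary in the induction because the sides of a 2-separation live in contracted
    graphs. *)
Lemma excess_bound n e U m : minor_free e -> star e U m ->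
  #|hubs U m| <= n -> excess e U m <= 4 * (#|hubs U m| - 3).
Proof.
elim: n e U => [|n IH] e U mf st Dn; first by rewrite (excess_small st) //; lia.
have e_sym : symmetric e by case: mf.
set D := hubs U m in Dn *; set h := contract e U m.
have [D3|D4] := leqP #|D| 3; first by rewrite (excess_small st).
have subU A : preimage U m A \subset U.
  by apply/subsetP => x; rewrite in_set => /andP[].
have mD x : x \in U -> m x \in D by apply: (owner_hub st).
have CD x c : c \in outs e U m x -> c \in D /\ c != m x by case/outsP.
have leO (A : {set T}) e' U' x : outs e U m x :&: A \subset outs e' U' m x ->
    outs e U m x \subset A -> #|outs e U m x| <= #|outs e' U' m x|.
  by move=> s /setIidPl E; rewrite -{1}E; apply: subset_leq_card.
have noCross L P x c : separated e U m L P -> x \in U -> m x \in L ->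
    c \in outs e U m x -> c \notin P.
  move=> /separatedP sep xU xL cx; apply/negP => cP.
  by have := outs_quotient xU cx; rewrite sep.
(* A cut vertex [d] of the quotient has at most two straddling vertices, each
   losing 2, and 4(|L|+1-3) + 4(|P|+1-3) + 4 <= 4(|D|-3). *)
have [/existsP[d /andP[dD nconn]]|/existsPn conn1] :=
  boolP [exists d, (d \in D) && ~~ connected h (D :\ d)].
  have [L [sL L0 P0 sep X2]] := one_separation mf st dD nconn.
  set P := D :\ d :\: L in P0 sep X2.
  have sP : P \subset D :\ d := subsetDl _ _.
  have dN (A : {set T}) : A \subset D :\ d -> d \notin A.
    by move=> /subsetP sA; apply/negP => /sA; rewrite in_setD1 eqxx.
  have sU1 (A : {set T}) : A \subset D :\ d -> d |: A \subset D.
    by move=> sA; rewrite subUset sub1set dD (subset_trans sA) ?subsetDl.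
  have cardD : #|D| = #|L| + #|P| + 1.
    by rewrite (cardsD1 d) dD -(cardsID L (D :\ d)) (setIidPr sL) -/P add1n addn1.
  have [st1 h1] := star_sub st (sU1 _ sL); have [st2 h2] := star_sub st (sU1 _ sP).
  have L1 : 0 < #|L| by rewrite card_gt0.
  have P1 : 0 < #|P| by rewrite card_gt0.
  have c1 : #|d |: L| = #|L| + 1 by rewrite cardsU1 dN // addnC.
  have c2 : #|d |: P| = #|P| + 1 by rewrite cardsU1 dN // addnC.
  have b1 := IH e _ mf st1; have b2 := IH e _ mf st2.
  rewrite h1 c1 in b1; rewrite h2 c2 in b2.
  have DE c : c \in D -> [\/ c = d, c \in L | c \in P].
    move=> cD; have [->|ncd] := eqVneq c d; first by constructor 1.
    have [cL|cL] := boolP (c \in L); first by constructor 2.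
    by constructor 3; rewrite in_setD cL in_setD1 ncd.
  have sepC := separatedC e_sym sep.
  have E : excess e U m <= excess e (preimage U m (d |: L)) m +
      excess e (preimage U m (d |: P)) m + 2 * #|straddlers e U m d L P|.
    apply: (excess_split (subU _) (subU _)) => x xU nx; set o := outs e U m x.
    have s1 := outs_sub st x (sU1 _ sL); have s2 := outs_sub st x (sU1 _ sP).
    have [xd|xL|xP] := DE _ (mD x xU).
    - have x1 : x \in preimage U m (d |: L) by rewrite in_set xU xd setU11.
      have x2 : x \in preimage U m (d |: P) by rewrite in_set xU xd setU11.
      have oLP c : c \in o -> c \notin L -> c \in P.
        by case/CD => /DE[->|->|//]; rewrite // xd eqxx.
      have [xS|xS] := boolP (x \in straddlers e U m d L P).
        have : #|o| <= #|outs e (preimage U m (d |: L)) m x| +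
                       #|outs e (preimage U m (d |: P)) m x|.
          rewrite -(cardsID L o); apply: leq_add; apply: subset_leq_card.
            by apply: subset_trans s1; apply: setIS; apply: subsetUr.
          apply/subsetP => c; rewrite in_setD => /andP[cL co].
          by apply: (subsetP s2); rewrite in_setI co in_setU1 oLP // orbT.
        rewrite x1 x2 !mul1n /=; clear; lia.
      have [oL|oL] := eqVneq (o :&: L) set0.
        apply: pay_right x2; apply: leO s2 _; apply/subsetP => c co.
        rewrite in_setU1 oLP ?orbT //; apply/negP => cL.
        by move/setP: oL => /(_ c); rewrite in_setI co cL in_set0.
      have oP : o :&: P = set0.
        apply/eqP; apply: contraNT xS => oP; apply/straddlersP; split=> //.
        by rewrite -xd eq_sym.
      apply: pay_left x1; apply: leO s1 _; apply/subsetP => c co.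
      rewrite in_setU1; have [//|cL] := boolP (c \in L); first by rewrite orbT.
      by move/setP: oP => /(_ c); rewrite in_setI co oLP // in_set0.
    - apply: pay_left; last by rewrite in_set xU in_setU1 xL orbT.
      apply: leO s1 _; apply/subsetP => c co; have [cD _] := CD _ _ co.
      have := noCross _ _ _ _ sep xU xL co; rewrite in_setU1.
      by case/DE: cD => [->|->|->]; rewrite ?eqxx ?orbT.
    apply: pay_right; last by rewrite in_set xU in_setU1 xP orbT.
    apply: leO s2 _; apply/subsetP => c co; have [cD _] := CD _ _ co.
    have := noCross _ _ _ _ sepC xU xP co; rewrite in_setU1.
    by case/DE: cD => [->|->|->]; rewrite ?eqxx ?orbT.
  (* If |L| = 1, truncation makes the bound of that side 0 instead of -4, which uses up the slack of
     4, and likewise for [P]. Both cannot happen at once, since [D4] excludes |D| = 3. *)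
  move: E X2 b1 b2 cardD L1 P1 D4 Dn; clear.
  move: (excess _ _ _) (excess _ _ _) (excess _ _ _) #|straddlers _ _ _ _ _ _|.
  move: #|D| #|L| #|P| => *; lia.
have {}conn1 d : d \in D -> connected h (D :\ d).
  by move=> dD; have := conn1 d; rewrite dD negbK.
have [/existsP[d /existsP[c /and4P[dD cD ndc nconn]]]|none] := boolP [exists d,
  exists c, [&& d \in D, c \in D, d != c & ~~ connected h (D :\ d :\ c)]];
  last first.
  apply: (excess_three_connected mf st D4) => d c dD cD ndc.
  apply: contraT => nconn; case/negP: none; apply/existsP; exists d.
  by apply/existsP; exists c; apply/and4P.
(* Now up to four straddling vertices lose 1 each: on each side the other side
   survives as an adjacency between [d] and [c]. *)
have [L [P [[EB dLP L0 P0 sep] [conn_cP conn_dL Xd Xc]]]] :=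
  two_separation mf st dD cD ndc (conn1 d dD) (conn1 c cD) nconn.
have memB x : x \in L \/ x \in P -> [/\ x != c, x != d & x \in D].
  by move/setUP; rewrite EB !in_setD1 => /and3P[].
have sP : P \subset D :\ d :\ c by rewrite -EB subsetUr.
have sL : L \subset D :\ c :\ d.
  apply/subsetP => x xL; have [? ? ?] := memB x (or_introl xL).
  by rewrite !in_setD1; apply/and3P.
have [e1 [mf1 st1 o1 q1]] := contracted_side mf st dD cD ndc sP conn_cP.
have ncd : c != d by rewrite eq_sym.
have [e2 [mf2 st2 o2 q2]] := contracted_side mf st cD dD ncd sL conn_dL.
set U1 := preimage U m (D :\: P) in st1 o1 q1.
set U2 := preimage U m (D :\: L) in st2 o2 q2.
have [_ h1] := star_sub st (subsetDl D P : D :\: P \subset hubs U m).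
have [_ h2] := star_sub st (subsetDl D L : D :\: L \subset hubs U m).
have LP x : x \in L -> x \notin P by move=> xL; rewrite (disjointFr dLP xL).
have PL x : x \in P -> x \notin L by move=> xP; rewrite (disjointFl dLP xP).
have DE x : x \in D -> [\/ x = d, x = c, x \in L | x \in P].
  move=> xD; have [->|nxd] := eqVneq x d; first by constructor 1.
  have [->|nxc] := eqVneq x c; first by constructor 2.
  have : x \in L :|: P by rewrite EB !in_setD1 nxd nxc.
  by rewrite in_setU => /orP[]; [constructor 3|constructor 4].
have nLP x : x \in D -> x \notin L -> x \notin P -> x = d \/ x = c.
  by move=> /DE[]; [left|right|move=> ->|move=> ->].
have dNL : d \notin L.
  by apply/negP => dL; have [_] := memB d (or_introl dL); rewrite eqxx.
have dNP : d \notin P.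
  by apply/negP => dP; have [_] := memB d (or_intror dP); rewrite eqxx.
have cNL : c \notin L.
  by apply/negP => cL; have [] := memB c (or_introl cL); rewrite eqxx.
have E : excess e U m <= excess e1 U1 m + excess e2 U2 m +
    1 * #|straddlers e U m d L P :|: straddlers e U m c L P|.
  apply: (excess_split (subU _) (subU _)) => x xU nx; set o := outs e U m x.
  have oP y : o :&: P = set0 -> y \in o -> y \in D :\: P.
    move=> oP0 yo; have [yD _] := CD _ _ yo; rewrite in_setD yD andbT.
    by apply/negP => yP; move/setP: oP0 => /(_ y); rewrite in_setI yo yP in_set0.
  have oL y : o :&: L = set0 -> y \in o -> y \in D :\: L.
    move=> oL0 yo; have [yD _] := CD _ _ yo; rewrite in_setD yD andbT.
    by apply/negP => yL; move/setP: oL0 => /(_ y); rewrite in_setI yo yL in_set0.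
  have left_side : x \in U1 -> o :&: P = set0 -> #|o| <= #|outs e1 U1 m x|.
    by move=> x1 oP0; apply: leO (o1 x x1) _; apply/subsetP => y; apply: oP.
  have right_side : x \in U2 -> o :&: L = set0 -> #|o| <= #|outs e2 U2 m x|.
    by move=> x2 oL0; apply: leO (o2 x x2) _; apply/subsetP => y; apply: oL.
  have U1E : m x \notin P -> x \in U1 by rewrite in_set xU in_setD mD // => ->.
  have U2E : m x \notin L -> x \in U2 by rewrite in_set xU in_setD mD // => ->.
  have cross (A B : {set T}) : separated e U m A B -> m x \in A -> o :&: B = set0.
    move=> sAB xA; apply/setP => y; rewrite in_setI in_set0; apply/negP => /andP[yo].
    by apply/negP; apply: noCross sAB xU xA yo.
  have [xL|xL] := boolP (m x \in L).
    have x1 := U1E (LP _ xL); apply: (pay_left _ _ _ _ x1); apply: left_side => //.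
    exact: (cross _ _ sep xL).
  have [xP|xP] := boolP (m x \in P).
    have x2 := U2E xL; apply: (pay_right _ _ _ _ x2); apply: right_side => //.
    exact: (cross _ _ (separatedC e_sym sep) xP).
  have x1 := U1E xP; have x2 := U2E xL.
  have [oP0|oP0] := eqVneq (o :&: P) set0.
    by apply: (pay_left _ _ _ _ x1); apply: left_side.
  have [oL0|oL0] := eqVneq (o :&: L) set0.
    by apply: (pay_right _ _ _ _ x2); apply: right_side.
  have -> : x \in straddlers e U m d L P :|: straddlers e U m c L P.
    rewrite in_setU; apply/orP.
    by have [xd|xc] := nLP _ (mD x xU) xL xP; [left|right];
       apply/straddlersP; split; rewrite // -?xd -?xc eq_sym.
  have sub1 : o :\: P \subset outs e1 U1 m x.
    apply: subset_trans (o1 x x1); apply/subsetP => y; rewrite in_setD in_setI.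
    by move=> /andP[yP yo]; have [yD _] := CD _ _ yo; rewrite yo in_setD yP.
  have sub2 : o :\: L \subset outs e2 U2 m x.
    apply: subset_trans (o2 x x2); apply/subsetP => y; rewrite in_setD in_setI.
    by move=> /andP[yL yo]; have [yD _] := CD _ _ yo; rewrite yo in_setD yL.
  have sub1' : o :&: L \subset outs e1 U1 m x.
    apply: subset_trans sub1; apply/subsetP => y /setIP[yo yL].
    by rewrite in_setD yo LP.
  have sub2' : o :&: P \subset outs e2 U2 m x.
    apply: subset_trans sub2; apply/subsetP => y /setIP[yo yP].
    by rewrite in_setD yo PL.
  have pos1 : 0 < #|outs e1 U1 m x|.
    by apply: leq_trans (subset_leq_card sub1'); rewrite card_gt0.
  have pos2 : 0 < #|outs e2 U2 m x|.
    by apply: leq_trans (subset_leq_card sub2'); rewrite card_gt0.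
  (* A straddling vertex of the block of d gains c on the side of [L], where [P] was merged into c.
     One of the block of c gains d on the side of [P], where [L] was merged into d. *)
  have : #|o| < #|outs e1 U1 m x| + #|outs e2 U2 m x|.
    have [xd|xc] := nLP _ (mD x xU) xL xP.
      exact: card_straddle sub1' (q1 x x1 xd oP0) cNL sub2.
    rewrite addnC; exact: card_straddle sub2' (q2 x x2 xc oL0) dNP sub1.
  rewrite x1 x2 !mul1n /= -/U1 -/U2; move: pos1 pos2; clear; lia.
have cD1 : #|D| = #|L| + #|P| + 2.
  rewrite (cardsD1 d) dD (cardsD1 c (D :\ d)) in_setD1 ncd cD -EB cardsU.
  move: dLP; rewrite -setI_eq0 => /eqP->; rewrite cards0 subn0; clear; lia.
have L1 : 0 < #|L| by rewrite card_gt0.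
have P1 : 0 < #|P| by rewrite card_gt0.
have c1 : #|D :\: P| = #|L| + 2.
  rewrite cardsD (setIidPr _) ?cD1; first by rewrite addnAC addnK.
  by apply/subsetP => x xP; have [] := memB x (or_intror xP).
have c2 : #|D :\: L| = #|P| + 2.
  rewrite cardsD (setIidPr _) ?cD1; first by rewrite -addnA addKn.
  by apply/subsetP => x xL; have [] := memB x (or_introl xL).
have b1 := IH e1 _ mf1 st1; have b2 := IH e2 _ mf2 st2.
rewrite h1 c1 in b1; rewrite h2 c2 in b2.
have X4 := leq_card_setU (straddlers e U m d L P) (straddlers e U m c L P).
have {}X4 : #|straddlers e U m d L P :|: straddlers e U m c L P| <= 4.
  by apply: leq_trans X4 _; apply: (leq_add Xd Xc).
move: E X4 b1 b2 cD1 L1 P1 D4 Dn; clear.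
move: (excess _ _ _) (excess _ _ _) (excess _ _ _) #|_ :|: _|.
move: #|D| #|L| #|P| => *; lia.
Qed.

End Stars.

Local Open Scope ring_scope.

Lemma pos_part_nat (k l : nat) : pos_part (k%:Z - l%:Z) = (k - l)%N%:Z.
Proof.
rewrite /pos_part; have [le|lt] := leqP l k.
  by rewrite -subzn // max_l // subr_ge0 lez_nat.
rewrite (eqP (_ : (k - l)%N == 0%N)) ?subn_eq0 1?ltnW //.
by rewrite max_r // subr_le0 lez_nat ltnW.
Qed.

Lemma W_excess (T : finType) (e : rel T) (D : {set T}) (m : T -> T) :
  owner_assignment e D m ->
  [/\ star e [set: T] m, hubs [set: T] m = D &
      W e D m = (excess e [set: T] m)%:Z].
Proof.
case=> mD mid edge; have inD x : (x \in D) = (m x == x).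
  by apply/idP/eqP => [/mid//|<-].
have hE : hubs [set: T] m = D by apply/setP => x; rewrite !inE inD.
split=> //.
  move=> u _; split; [by rewrite inE | exact: mid | by rewrite -inD => /edge].
rewrite /W /excess (big_morph Posz PoszD (erefl _)).
apply: eq_big => [x|x xD]; first by rewrite inE inD.
rewrite (pos_part_nat _ 2); congr (Posz (_ - 2)); apply: eq_card => c.
rewrite /outs hE !inE -andbA andbCA; congr [&& _, _ & _].
apply/set0Pn/exists_inP => [[v]|[v _ /andP[vc xv]]]; last by exists v; rewrite !inE xv.
by rewrite !inE => /andP[xv vc]; exists v; rewrite ?inE ?vc.
Qed.

Theorem theorem2p6 (R : realType) (T : finType) (e : rel T)
    (e_sym : symmetric e) (e_irr : irreflexive e) (G_planar : planar R e)
    (D : {set T}) (D_dom : dominating e D)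
    (m : T -> T) (m_owner : owner_assignment e D m) :
  W e D m <= pos_part (4 * #|D|%:Z - 12) /\
  (0 < W e D m -> W e D m <= 4 * #|D|%:Z - 12).
Proof.
have [st hE ->] := W_excess m_owner.
have mf := planar_minor_free e_sym e_irr G_planar.
have := excess_bound mf st (leqnn _); rewrite hE => le.
have E : 4 * #|D|%:Z - 12 = (4 * #|D|)%N%:Z - 12%N%:Z by rewrite PoszM.
rewrite E pos_part_nat lez_nat; split; first by rewrite -(mulnBr 4 _ 3).
rewrite ltz_nat => pos; rewrite lerBrDr -PoszD lez_nat.
(* A positive weight forces |D| > 3, where the truncated subtraction is exact. *)
by move: le pos; lia.
Qed.
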